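(* Let $p_1,\dots,p_n$, $p_j(c;x)=x^{\alpha_j}-c_jx^{\beta_j}$, be a binomial system which is a generic complete intersection, with all $\alpha_j,\beta_j$ non-zero, and suppose that $p_n=x_n^{\ell}-c_nx_{n-1}^{m}$ with $\ell,m$ coprime positive integers. Let $\tilde p_1,\dots,\tilde p_{n-1}$ be the binomial system in the variables $u_1,\dots,u_{n-1}$ obtained through parametric reduction. Let $d,D,\mu_L$ ($L\subset[n]$) be the invariants of $p_1,\dots,p_n$ and $\tilde d,\tilde D,\mu_{\tilde L}$ ($\tilde L\subset[n-1]$) those of $\tilde p_1,\dots,\tilde p_{n-1}$. Then $D=\tilde D$ and, for any $L\subset[n]$, setting $\tilde L:=L\cap[n-1]$, $$\mu_L=\mu_{\tilde L}.$$ Consequently, $d=\tilde d$ as well.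
   Context: $k$ is a field of characteristic zero with algebraic closure $\bar k$; $[n]=\{1,\dots,n\}$; $\mathbb{N}$ includes $0$. A binomial system is $p_j(c;x)=x^{\alpha_j}-c_jx^{\beta_j}$, $j=1,\dots,n$, with $\alpha_j,\beta_j\in\mathbb{N}^n$, $\alpha_j\neq\beta_j$. For $c\in(k^* )^n$, $\mathcal{J}_c\subset k[x_1,\dots,x_n]$ is the ideal generated by the $p_j(c;x)$ and $\mathbb{V}_c\subset\bar k^n$ its zero set; $\mathcal{J}_c$ is a complete intersection if $\mathbb{V}_c$ is finite and non-empty. The system is a generic complete intersection (gci) if this holds for generic $c\in(k^* )^n$. For a gci: $d$ (resp. $D$) is the number of points of $\mathbb{V}_c$ counted with (resp. without) multiplicity, for generic $c$; for $L\subset[n]$, $\bar k^n_L=\{x\in\bar k^n: x_\ell=0\text{ if and only if }\ell\in L\}$ and $\mu_L$ is the number of points of $\mathbb{V}_c\cap\bar k^n_L$ counted with multiplicity, for generic $c$. The multiplicity of a point is the dimension over $\bar k$ of the local ring of $\bar k[x]/\mathcal{J}_c\bar k[x]$ at that point. The same definitions apply to systems of $n-1$ binomials in $n-1$ variables. Parametric reduction (for $\ell,m$ coprime): $\tilde p_1,\dots,\tilde p_{n-1}$ are the images of $p_1,\dots,p_{n-1}$ under the substitution $x_i\mapsto u_i$ ($i=1,\dots,n-2$), $x_{n-1}\mapsto u_{n-1}^{\ell}$, $x_n\mapsto u_{n-1}^{m}$. The system $\tilde p_1,\dots,\tilde p_{n-1}$ is again a gci, so its invariants are defined.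
   Formalization: The equality μ_L = μ_{L̃} is stated only for L containing both or neither of n−1, n; for all other L it is replaced by μ_L = 0, since the equality fails there (e.g. p_1 = x_1^2 − c_1x_2, p_2 = x_2 − c_2x_1, L = {2}). *)

(* Defs.v *)
From HB Require Import structures.
From mathcomp Require Import all_boot all_order all_algebra.
From mathcomp.multinomials Require Import mpoly.
From Stdlib Require Import ClassicalEpsilon.

Set Implicit Arguments.
Unset Strict Implicit.
Unset Printing Implicit Defensive.

Import GRing.Theory.
Local Open Scope ring_scope.

Definition ideal_gen (K : fieldType) (n r : nat) (p : 'I_r -> {mpoly K[n]})
    (f : {mpoly K[n]}) : Prop :=
  exists q : 'I_r -> {mpoly K[n]}, f = \sum_(j < r) q j * p j.

(* O_x = { f/g : g(x) <> 0 } inside the fraction field of K[x_1,...,x_n]. *)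
Definition in_local_ring (K : fieldType) (n : nat) (x : {ffun 'I_n -> K})
    (z : {fraction {mpoly K[n]}}) : Prop :=
  exists f g : {mpoly K[n]}, g.@[x] != 0 /\ z = tofrac f / tofrac g.

(* The extension J O_x of an ideal J of K[x_1,...,x_n]. *)
Definition in_local_ideal (K : fieldType) (n : nat) (x : {ffun 'I_n -> K})
    (J : {mpoly K[n]} -> Prop) (z : {fraction {mpoly K[n]}}) : Prop :=
  exists f g : {mpoly K[n]}, [/\ J f, g.@[x] != 0 & z = tofrac f / tofrac g].

(* The local ring of K[x_1,...,x_n]/J at x is O_x / J O_x; its K-dimension is N
   when some e_1, ..., e_N in O_x induce a K-basis of O_x / J O_x, i.e. every
   class is a K-linear combination of the e_i in exactly one way. *)
Definition has_mult (K : fieldType) (n : nat) (J : {mpoly K[n]} -> Prop)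
    (x : {ffun 'I_n -> K}) (N : nat) : Prop :=
  exists e : 'I_N -> {fraction {mpoly K[n]}},
    (forall i, in_local_ring x (e i)) /\
    (forall z, in_local_ring x z ->
       exists! a : {ffun 'I_N -> K},
         in_local_ideal x J (z - \sum_(i < N) tofrac (a i)%:MP_[n] * e i)).

Definition finite_points (T : eqType) (S : T -> Prop) : Prop :=
  exists s : seq T, forall x, S x <-> x \in s.

Definition has_card (T : eqType) (S : T -> Prop) (N : nat) : Prop :=
  exists s : seq T, [/\ uniq s, forall x, S x <-> x \in s & size s = N].

Definition has_card_mult (K : fieldType) (n : nat) (J : {mpoly K[n]} -> Prop)
    (S : {ffun 'I_n -> K} -> Prop) (N : nat) : Prop :=
  exists (s : seq {ffun 'I_n -> K}) (w : {ffun 'I_n -> K} -> nat),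
    [/\ uniq s, forall x, S x <-> x \in s,
        forall x, x \in s -> has_mult J x (w x)
      & N = (\sum_(x <- s) w x)%N].

(* P holds on a nonempty Zariski-open subset of the torus (k^* )^n. *)
Definition generic (k : fieldType) (n : nat) (P : ('I_n -> k) -> Prop) : Prop :=
  exists2 g : {mpoly k[n]}, g != 0 &
    forall c : 'I_n -> k, (forall j, c j != 0) -> g.@[c] != 0 -> P c.

(* The value N for which P c N holds for generic c; over an infinite field
   there is at most one such N as soon as each P c is single-valued. It is
   arbitrary when there is none. *)
Definition generic_value (k : fieldType) (n : nat)
    (P : ('I_n -> k) -> nat -> Prop) : nat :=
  epsilon (inhabits 0%N) (fun N => generic (fun c => P c N)).

Definition psystem (k : fieldType) (n : nat) : Type :=
  ('I_n -> k) -> 'I_n -> {mpoly k[n]}.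

Definition binomial_poly (k : fieldType) (n : nat) (a b : 'X_{1..n}) (c : k) :
  {mpoly k[n]} := 'X_[a] - c *: 'X_[b].

Definition binomial_system (k : fieldType) (n : nat)
    (alpha beta : 'I_n -> 'X_{1..n}) : psystem k n :=
  fun c j => binomial_poly (alpha j) (beta j) (c j).

Arguments binomial_system k {n} alpha beta _ _.

(* Throughout, kb with iota : k -> kb plays the role of the algebraic closure
   of k. *)
Definition zero_set (k kb : fieldType) (iota : {rmorphism k -> kb}) (n : nat)
    (p : psystem k n) (c : 'I_n -> k) (x : {ffun 'I_n -> kb}) : Prop :=
  forall f, ideal_gen (p c) f -> (map_mpoly iota f).@[x] = 0.

Definition ext_ideal (k kb : fieldType) (iota : {rmorphism k -> kb}) (n : nat)
    (p : psystem k n) (c : 'I_n -> k) : {mpoly kb[n]} -> Prop :=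
  ideal_gen (fun j => map_mpoly iota (p c j)).

Definition stratum (K : fieldType) (n : nat) (L : {set 'I_n})
    (x : {ffun 'I_n -> K}) : Prop :=
  forall i, x i = 0 <-> i \in L.

Definition gci (k kb : fieldType) (iota : {rmorphism k -> kb}) (n : nat)
    (p : psystem k n) : Prop :=
  generic (fun c => finite_points (zero_set iota p c) /\
                    exists x, zero_set iota p c x).

Definition inv_d (k kb : fieldType) (iota : {rmorphism k -> kb}) (n : nat)
    (p : psystem k n) : nat :=
  generic_value (fun c =>
    has_card_mult (ext_ideal iota p c) (zero_set iota p c)).

Definition inv_D (k kb : fieldType) (iota : {rmorphism k -> kb}) (n : nat)
    (p : psystem k n) : nat :=
  generic_value (fun c => has_card (zero_set iota p c)).

Definition inv_mu (k kb : fieldType) (iota : {rmorphism k -> kb}) (n : nat)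
    (p : psystem k n) (L : {set 'I_n}) : nat :=
  generic_value (fun c =>
    has_card_mult (ext_ideal iota p c)
      (fun x => zero_set iota p c x /\ stratum L x)).

(* With n.+2 variables x_1, ..., x_{n+2} indexed by 'I_n.+2, the last variable
   is ord_max, the one before it is penult n, and lift ord_max : 'I_n.+1 ->
   'I_n.+2 is the value-preserving inclusion of the first n.+1 indices. *)
Definition penult (n : nat) : 'I_n.+2 := lift ord_max ord_max.

Definition reduction_subst (k : fieldType) (n l m : nat) :
    (n.+2).-tuple {mpoly k[n.+1]} :=
  [tuple match unlift ord_max i with
         | None => 'X_ord_max ^+ m
         | Some j => if j == ord_max then 'X_ord_max ^+ l else 'X_j
         end | i < n.+2].

(* The images of the first n.+1 binomials; no condition excludes that both
   monomials of such an image coincide. *)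
Definition reduced_system (k : fieldType) (n l m : nat)
    (alpha beta : 'I_n.+2 -> 'X_{1..n.+2}) : psystem k n.+1 :=
  fun c j =>
    binomial_poly (alpha (lift ord_max j)) (beta (lift ord_max j)) (c j)
      \mPo reduction_subst k n l m.

Arguments reduced_system k {n} l m alpha beta _ _.

Definition restrict_set (n : nat) (L : {set 'I_n.+2}) : {set 'I_n.+1} :=
  [set j | lift ord_max j \in L].

(* Main.v *)
Require Import Defs.
From HB Require Import structures.
From mathcomp Require Import all_boot all_order all_algebra.
From mathcomp Require Import ring cyclic separable cyclotomic.
From mathcomp.multinomials Require Import ssrcomplements mpoly.
From Stdlib Require Import Classical ClassicalEpsilon.
From Stdlib Require Import FunctionalExtensionality PropExtensionality.

(* The substitution x_i = t_i u_i (i < n-1), x_(n-1) = t_(n-1) u_(n-1)^l,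
   x_n = t_n u_(n-1)^m, with t_(n-1) = c_n^b and t_n = c_n^a where
   a l = b m + 1, maps the zeros of the reduced system at rescaled (monomial in
   c) parameters bijectively onto the zeros of p, so it suffices to compare
   multiplicities for c_n = 1 and to pull genericity back and forth along the
   monomial map of parameters.

   Where u_(n-1) <> 0 the curve y^l = x^m is smooth and u = x^a / y^b inverts
   the parametrization. Where u_(n-1) = 0, pull back along x = X^l: the ring
   becomes free of rank l over the old one, so all multiplicities are multiplied
   by l, while y^l - X^(lm) splits into the l factors y - (zeta X)^m, each of
   which gives the multiplicity of the reduced system. Additivity of the
   multiplicity over the factors needs y - (zeta X)^m to be a non zero divisor
   modulo the other equations, which is the unmixedness theorem for a regular
   local ring; it is obtained from the vanishing of Koszul homology. *)

Set Implicit Arguments.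
Unset Strict Implicit.
Unset Printing Implicit Defensive.

Import GRing.Theory.
Local Open Scope ring_scope.

(** * Bases modulo a subspace *)

(** At the singular point, for l, m > 1, the parametrization induces no isomorphism: K[x,y]/(y^l -
    x^m) is a proper subring of K[u], and after dividing by the other equations only the dimensions
    can be expected to agree. Hence the detour through the cover, on which each factor of the cusp
    equation is a smooth graph; the dimension is found there l times on both sides, and l cancels.

    The invariants are values chosen by [epsilon], so two of them are shown equal by showing that
    each N is admissible for both or for neither. Comparisons of multiplicities are therefore
    equivalences for every N, and finiteness has to be carried in both directions; [codim_le] serves
    for this.

    Local rings are replaced by K[x] modulo the contraction of J O_x. Nothing is lost in finite
    dimension, where a polynomial that does not vanish at x is invertible modulo this
    contraction. *)

Section Codimension.
Variables (K : fieldType) (V : lmodType K).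
Implicit Types (W : V -> Prop).

Definition subspace W :=
  [/\ W 0, forall u v, W u -> W v -> W (u + v) & forall a u, W u -> W (a *: u)].

Definition spanning W (I : finType) (e : I -> V) :=
  forall z, exists a : I -> K, W (z - \sum_i a i *: e i).

Definition independent W (I : finType) (e : I -> V) :=
  forall a : I -> K, W (\sum_i a i *: e i) -> forall i, a i = 0.

Definition codim W (N : nat) :=
  exists e : 'I_N -> V, spanning W e /\ independent W e.

(** A bound on the dimension that mentions no basis. It passes to larger subspaces and to preimages,
    and [codim_le_codim] turns it back into a basis. *)
Definition codim_le W (M : nat) :=
  forall z : 'I_M.+1 -> V,
    exists a : 'I_M.+1 -> K, (exists i, a i != 0) /\ W (\sum_i a i *: z i).

Lemma exists_dependence (M : nat) (A : 'I_M.+1 -> 'I_M -> K) :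
  exists a : 'I_M.+1 -> K,
    (exists i, a i != 0) /\ forall j, \sum_i a i * A i j = 0.
Proof.
pose B := \matrix_(i, j) A i j.
have : kermx B != 0.
  rewrite kermx_eq0 /row_free neq_ltn; apply/orP; left.
  by rewrite ltnS rank_leq_col.
case/rowV0Pn=> v /sub_kermxP vB v0.
exists (fun i => v ord0 i); split.
  apply/existsP; apply: contraNT v0; rewrite negb_exists => /forallP v0.
  by apply/eqP/rowP => i; rewrite mxE; apply/eqP; have := v0 i; rewrite negbK.
move=> j; have := congr1 (fun X : 'rV_M => X ord0 j) vB.
rewrite [RHS]mxE mxE; apply: etrans; by apply: eq_bigr => i _; rewrite mxE.
Qed.

(** [coord] is an arbitrary function, so that coordinates obtained by choice are allowed. *)
Lemma codim_le_coord W (M : nat) (coord : V -> 'I_M -> K) :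
  (forall (a : 'I_M.+1 -> K) z,
     (forall j, \sum_i a i * coord (z i) j = 0) -> W (\sum_i a i *: z i)) ->
  codim_le W M.
Proof.
move=> cW z; have [a [a0 az]] := exists_dependence (fun i => coord (z i)).
by exists a; split=> //; apply: cW.
Qed.

Variable W : V -> Prop.
Hypothesis W_sub : subspace W.

Lemma subspace0 : W 0. Proof. by case: W_sub. Qed.
Lemma subspaceD u v : W u -> W v -> W (u + v).
Proof. by case: W_sub => _ + _; apply. Qed.
Lemma subspaceZ a u : W u -> W (a *: u).
Proof. by case: W_sub => _ _; apply. Qed.
Lemma subspaceN u : W u -> W (- u).
Proof. by rewrite -scaleN1r; apply: subspaceZ. Qed.

Lemma subspaceB u v : W u -> W v -> W (u - v).
Proof. by move=> ? /subspaceN; apply: subspaceD. Qed.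

Lemma subspace_sum (I : Type) (r : seq I) (P : pred I) (F : I -> V) :
  (forall i, P i -> W (F i)) -> W (\sum_(i <- r | P i) F i).
Proof.
by move=> WF; elim/big_ind: _ => //; [apply: subspace0|apply: subspaceD].
Qed.

Lemma subspace_trans v u w : W (u - v) -> W (v - w) -> W (u - w).
Proof. by move=> uv /(subspaceD uv); rewrite addrA subrK. Qed.

Lemma spanning_codim_le M (I : finType) (e : I -> V) :
  spanning W e -> #|I| = M -> codim_le W M.
Proof.
move=> We cI; subst M.
pose c z := proj1_sig (constructive_indefinite_description _ (We z)).
have cP z : W (z - \sum_i c z i *: e i).
  exact: proj2_sig (constructive_indefinite_description _ (We z)).
apply: (@codim_le_coord W _ (fun z j => c z (enum_val j))) => a z az.
have -> : \sum_i a i *: z i = \sum_i a i *: (z i - \sum_j c (z i) j *: e j).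
  apply/eqP; rewrite -subr_eq0 -sumrB (eq_bigr _ (fun i _ => esym (scalerBr _ _ _))).
  under eq_bigr => i _ do rewrite subKr scaler_sumr.
  rewrite exchange_big big1 //= => j _.
  under eq_bigr => i _ do rewrite scalerA.
  rewrite -scaler_suml; have := az (enum_rank j).
  by under eq_bigr => i _ do rewrite enum_rankK; move=> ->; rewrite scale0r.
by apply: subspace_sum => i _; apply: subspaceZ; apply: cP.
Qed.

Lemma codim_codim_le M : codim W M -> codim_le W M.
Proof. by case=> e [We _]; apply: spanning_codim_le We _; rewrite card_ord. Qed.

Lemma independent_le M N (e : 'I_N -> V) :
  codim_le W M -> independent W e -> (N <= M)%N.
Proof.
move=> WM We; rewrite leqNgt; apply/negP => MN.
have [a [[i ai] Wa]] := WM (fun i => e (widen_ord MN i)).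
pose b (j : 'I_N) := if insub (val j) is Some i then a i else 0.
have bE k : b (widen_ord MN k) = a k by rewrite /b /= valK.
have := We b; rewrite (bigID (fun j : 'I_N => j < M.+1)%N) /=.
rewrite [X in _ + X]big1 ?addr0; last first.
  by move=> j /negbTE jM; rewrite /b insubF ?scale0r.
have -> : \sum_(j < N | (j < M.+1)%N) b j *: e j = \sum_k a k *: e (widen_ord MN k).
  rewrite (big_ord_narrow MN).
  by apply: eq_bigr => k _; rewrite bE.
by move=> /(_ Wa (widen_ord MN i)); rewrite bE => /eqP; rewrite (negbTE ai).
Qed.

Lemma codim_unique M N : codim W M -> codim W N -> M = N.
Proof.
move=> WM WN; apply/eqP; rewrite eqn_leq; case: (WM) (WN) => [e [_ ei]] [f [_ fi]].
by rewrite (independent_le (codim_codim_le WN) ei) (independent_le (codim_codim_le WM) fi).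
Qed.

Lemma extend_independent N (e : 'I_N -> V) z :
  independent W e -> (forall a : 'I_N -> K, ~ W (z - \sum_i a i *: e i)) ->
  independent W (fun i : 'I_N.+1 => oapp e z (unlift ord_max i)).
Proof.
move=> We nz a; rewrite big_ord_recr /= unlift_none /=.
under eq_bigr => i _.
  rewrite (_ : widen_ord _ i = lift ord_max i); last first.
    by apply: val_inj; rewrite /= /bump leqNgt ltn_ord.
  rewrite liftK /=; over.
move=> Wa; case: (eqVneq (a ord_max) 0) => [a0|a0]; last first.
  case: (nz (fun i => - (a ord_max)^-1 * a (lift ord_max i))).
  have := subspaceZ (a ord_max)^-1 Wa.
  rewrite scalerDr scalerA mulVf // scale1r addrC scaler_sumr.
  under [X in _ -> W (_ - X)]eq_bigr => i _ do rewrite mulNr scaleNr -scalerA.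
  by rewrite sumrN opprK.
move: Wa; rewrite a0 scale0r addr0 => /We a1 i.
by case: (unliftP ord_max i) => [j ->|->]; rewrite ?a1.
Qed.

(** An independent family that does not span is enlarged by a vector that it does not reach; the
    bound M stops this process. *)
Lemma codim_le_codim M : codim_le W M -> exists N, codim W N.
Proof.
move=> WM.
suff H d N (e : 'I_N -> V) : independent W e -> (M - N <= d)%N -> exists N, codim W N.
  apply: (H M 0%N (fun => 0)) => [a _ []//|]; exact: leq_subr.
elim: d N e => [|d IH] N e We dN;
  (case: (excluded_middle_informative (spanning W e)) => [Se|nSe]; first by exists N, e).
all: have [z nz] := not_all_ex_not _ _ nSe.
all: have {}We := extend_independent We (not_ex_all_not _ _ nz).
  by have := independent_le WM We; rewrite ltnNge -subn_eq0 -leqn0 dN.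
by apply: IH We _; move: dN; rewrite subnS; case: (M - N)%N.
Qed.

Lemma codim_card (I : finType) (e : I -> V) :
  spanning W e -> independent W e -> codim W #|I|.
Proof.
move=> Se We; exists (fun i => e (enum_val i)); split.
  move=> z; have [a Wa] := Se z; exists (fun i => a (enum_val i)).
  by rewrite (reindex _ (onW_bij _ (enum_val_bij I))) in Wa.
move=> a Wa i; rewrite -(enum_valK i).
apply: (We (fun i => a (enum_rank i))).
rewrite (reindex _ (onW_bij _ (enum_val_bij I))).
by under eq_bigr => j _ do rewrite enum_valK.
Qed.

End Codimension.

Lemma codim_le_preim (K : fieldType) (V V' : lmodType K) (L : {linear V -> V'})
    (W : V -> Prop) (W' : V' -> Prop) M :
  (forall u, W' (L u) -> W u) -> codim_le W' M -> codim_le W M.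
Proof.
move=> WW' W'M z; have [a [a0 Wa]] := W'M (fun i => L (z i)).
exists a; split=> //; apply: WW'; rewrite linear_sum.
by under eq_bigr => i _ do rewrite linearZ.
Qed.

(** * Koszul homology *)

Section Koszul.
Variables (S : comNzRingType) (f : nat -> S).

(* A chain over s.+1 generators is a pair (c1, c2), standing for
   c1 + c2 /\ e_s with c1, c2 chains over the first s generators. *)
Fixpoint koszul (s : nat) : lmodType S :=
  if s is s'.+1 then (koszul s' * koszul s')%type else S^o.

(** Interior product with f; the signs are those of e_s written to the left of c2. *)
Fixpoint kdiff (s : nat) : koszul s -> koszul s :=
  match s return koszul s -> koszul s with
  | 0 => fun=> 0
  | s'.+1 => fun c => (kdiff c.1 + f s' *: c.2, - kdiff c.2)
  end.

(** Exterior multiplication by the 1-chain with coefficients r; it raises the degree by one. *)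
Fixpoint kcontract (r : nat -> S) (s : nat) : koszul s -> koszul s :=
  match s return koszul s -> koszul s with
  | 0 => fun=> 0
  | s'.+1 => fun c => (kcontract r c.1, r s' *: c.1 - kcontract r c.2)
  end.

Fixpoint kdeg (s p : nat) : koszul s -> Prop :=
  match s return koszul s -> Prop with
  | 0 => fun c => p = 0%N \/ c = 0
  | s'.+1 => fun c =>
      kdeg p c.1 /\ if p is p'.+1 then kdeg p' c.2 else c.2 = 0
  end.

Fixpoint kin (I : S -> Prop) (s : nat) : koszul s -> Prop :=
  match s return koszul s -> Prop with
  | 0 => I
  | s'.+1 => fun c => kin I c.1 /\ kin I c.2
  end.

Lemma kdiffD s : {morph @kdiff s : c c' / c + c'}.
Proof.
elim: s => [|s IH] c c' /=; first by rewrite addr0.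
by congr (_, _); rewrite /= !IH ?opprD // scalerDr addrACA.
Qed.

Lemma kdiffZ s a (c : koszul s) : kdiff (a *: c) = a *: kdiff c.
Proof.
elim: s c => [|s IH] c /=; first by rewrite scaler0.
congr (_, _); rewrite /= !IH ?scalerN //.
by rewrite scalerDr !scalerA [a * _]mulrC.
Qed.

Lemma kdiffN s (c : koszul s) : kdiff (- c) = - kdiff c.
Proof. by rewrite -!scaleN1r kdiffZ. Qed.

Lemma kdiff0 s : kdiff (0 : koszul s) = 0.
Proof. by have := kdiffZ 0 (0 : koszul s); rewrite !scale0r. Qed.

Lemma kdiffK s (c : koszul s) : kdiff (kdiff c) = 0.
Proof.
elim: s c => [|s IH] c //=.
by rewrite !kdiffN kdiffD kdiffZ !IH scalerN add0r subrr opprK.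
Qed.

Lemma kcontractD r s : {morph @kcontract r s : c c' / c + c'}.
Proof.
elim: s => [|s IH] c c' /=; first by rewrite addr0.
by congr (_, _); rewrite /= !IH // scalerDr opprD addrACA.
Qed.

Lemma kcontractZ r s a (c : koszul s) : kcontract r (a *: c) = a *: kcontract r c.
Proof.
elim: s c => [|s IH] c /=; first by rewrite scaler0.
congr (_, _); rewrite /= !IH //.
by rewrite scalerBr !scalerA [a * _]mulrC.
Qed.

Lemma kcontract0 r s : kcontract r (0 : koszul s) = 0.
Proof. by have := kcontractZ r 0 (0 : koszul s); rewrite !scale0r. Qed.

(** Interior product with f and exterior product with r anticommute up to the pairing of r with f.
    Hence the ideal of f annihilates Koszul homology. *)
Lemma kcontract_homotopy r s (c : koszul s) :
  kdiff (kcontract r c) + kcontract r (kdiff c) = (\sum_(i < s) r i * f i) *: c.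
Proof.
elim: s c => [|s IH] c; first by rewrite big_ord0 scale0r addr0.
rewrite big_ord_recr; congr (_, _); rewrite /= scalerDl -IH.
  rewrite kcontractD kcontractZ scalerBr scalerA [r s * _]mulrC.
  by rewrite addrACA subrK.
rewrite kdiffD kdiffN kdiffZ scalerDr scalerA -[in kcontract r (- _)]scaleN1r.
rewrite kcontractZ scaleN1r opprK opprD opprK.
by rewrite -[_ + _ + kcontract _ _]addrA addrACA addNr add0r [(_ * _) *: _ + _]addrC addrA.
Qed.

Lemma kdegD s p (c c' : koszul s) : kdeg p c -> kdeg p c' -> kdeg p (c + c').
Proof.
elim: s p c c' => [|s IH] p c c' /=.
  by case=> [->|->]; [left|case=> [->|->]; [left|right; rewrite addr0]].
case=> c1 c2 [c1' c2']; split; first exact: IH.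
by case: p {c1 c1'} c2 c2' => [-> ->|p]; [rewrite addr0|apply: IH].
Qed.

Lemma kdegZ s p a (c : koszul s) : kdeg p c -> kdeg p (a *: c).
Proof.
elim: s p c => [|s IH] p c /=; first by case=> [->|->]; [left|right; rewrite scaler0].
case=> c1 c2; split; first exact: IH.
by case: p {c1} c2 => [->|p]; [rewrite scaler0|apply: IH].
Qed.

Lemma kdegN s p (c : koszul s) : kdeg p c -> kdeg p (- c).
Proof. by rewrite -scaleN1r; apply: kdegZ. Qed.

Lemma kdeg0 s p : kdeg p (0 : koszul s).
Proof. by elim: s p => [|s IH] p /=; [right|split=> //; case: p]. Qed.

Lemma kdiff_deg0 s (c : koszul s) : kdeg 0 c -> kdiff c = 0.
Proof.
elim: s c => [|s IH] //= c [/IH -> ->].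
by rewrite kdiff0 scaler0 oppr0 addr0.
Qed.

Lemma kdeg_diff s p (c : koszul s) : kdeg p.+1 c -> kdeg p (kdiff c).
Proof.
elim: s p c => [|s IH] p c /=; first by right.
case=> c1 c2; split; first by apply: kdegD; [apply: IH|apply: kdegZ].
case: p c1 c2 => [|p] _ c2; last by apply: kdegN; apply: IH.
by rewrite /= kdiff_deg0 ?oppr0.
Qed.

Lemma kdeg_contract r s p (c : koszul s) : kdeg p c -> kdeg p.+1 (kcontract r c).
Proof.
elim: s p c => [|s IH] p c /=; first by right.
case=> c1 c2; split; first exact: IH.
apply: kdegD; first exact: kdegZ.
apply: kdegN; case: p c2 {c1} => [->|p]; last exact: IH.
by rewrite kcontract0; apply: kdeg0.
Qed.

Lemma kdeg_gt s p (c : koszul s) : (s < p)%N -> kdeg p c -> c = 0.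
Proof.
elim: s p c => [|s IH] [|p] c //=; first by move=> _ [|->].
case: c => c1 c2 /= sp [c1p c2p].
by rewrite (IH _ _ (ltnW sp) c1p) (IH _ _ sp c2p).
Qed.

Fixpoint kchain0 (s : nat) (x : S) : koszul s :=
  if s is s'.+1 then (kchain0 s' x, 0) else x.

Fixpoint kchain1 (s : nat) (q : nat -> S) : koszul s :=
  if s is s'.+1 then (kchain1 s' q, kchain0 s' (q s')) else 0.

Lemma kchain0_inj s : injective (kchain0 s).
Proof. by elim: s => [|s IH] x y //= [/IH]. Qed.

Lemma kchain0D s x y : kchain0 s (x + y) = kchain0 s x + kchain0 s y.
Proof. by elim: s => [|s IH] //=; congr (_, _); rewrite /= ?addr0. Qed.

Lemma kchain0Z s a x : kchain0 s (a * x) = a *: kchain0 s x.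
Proof. by elim: s => [|s IH] //=; congr (_, _); rewrite /= ?scaler0. Qed.

Lemma kdeg_chain0 s x : kdeg 0 (kchain0 s x).
Proof. by elim: s => [|s IH] /=; [left|]. Qed.

Lemma kdeg_chain1 s q : kdeg 1 (kchain1 s q).
Proof. by elim: s => [|s IH] /=; [right|split=> //; apply: kdeg_chain0]. Qed.

Lemma kdiff_chain1 s q : kdiff (kchain1 s q) = kchain0 s (\sum_(i < s) q i * f i).
Proof.
elim: s => [|s IH] /=; first by rewrite big_ord0.
rewrite IH kdiff_deg0 ?oppr0; last exact: kdeg_chain0.
by rewrite big_ord_recr /= kchain0D mulrC kchain0Z.
Qed.

Lemma kdeg0P s (c : koszul s) : kdeg 0 c -> exists x, c = kchain0 s x.
Proof.
elim: s c => [|s IH] c /=; first by exists c.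
by case: c => c1 c2 /= [/IH [x ->] ->]; exists x.
Qed.

Lemma eq_kchain1 s q q' :
  (forall i, (i < s)%N -> q i = q' i) -> kchain1 s q = kchain1 s q'.
Proof.
elim: s => [|s IH] qq' //=; congr (_, kchain0 _ _); last exact: qq'.
by apply: IH => i /ltnW; apply: qq'.
Qed.

Lemma kdeg1P s (c : koszul s) : kdeg 1 c -> exists q, c = kchain1 s q.
Proof.
elim: s c => [|s IH] c /=; first by case=> // ->; exists (fun=> 0).
case: c => c1 c2 /= [/IH [q ->] /kdeg0P [x ->]].
exists (fun i => if i == s then x else q i); rewrite eqxx; congr (_, _).
apply: eq_kchain1 => i; by rewrite ltn_neqAle => /andP[/negbTE->].
Qed.

Definition ideal (I : S -> Prop) :=
  [/\ I 0, forall a b, I a -> I b -> I (a + b) & forall a b, I b -> I (a * b)].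

(** For multiplicative U, the contraction of the extension of I to the localization at U. *)
Definition sat (U I : S -> Prop) (a : S) := exists g, U g /\ I (g * a).

Section Ideal.
Variables (I : S -> Prop).
Hypothesis I_ideal : ideal I.

Lemma kinD s (c c' : koszul s) : kin I c -> kin I c' -> kin I (c + c').
Proof.
elim: s c c' => [|s IH] c c' /=; first by case: I_ideal => _ + _; apply.
by case=> c1 c2 [c1' c2']; split; apply: IH.
Qed.

Lemma kinZ s a (c : koszul s) : kin I c -> kin I (a *: c).
Proof.
elim: s c => [|s IH] c /=; first by case: I_ideal => _ _; apply.
by case=> c1 c2; split; apply: IH.
Qed.

Lemma kinN s (c : koszul s) : kin I c -> kin I (- c).
Proof. by rewrite -scaleN1r; apply: kinZ. Qed.

Lemma kin0 s : kin I (0 : koszul s).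
Proof. by elim: s => [|s IH] //=; case: I_ideal. Qed.

Lemma kin_diff s (c : koszul s) : kin I c -> kin I (kdiff c).
Proof.
elim: s c => [|s IH] c; first by case: I_ideal.
by case=> c1 c2; split; [apply: kinD; [apply: IH|apply: kinZ]|apply: kinN; apply: IH].
Qed.

Lemma kin_contract r s (c : koszul s) : kin I c -> kin I (kcontract r c).
Proof.
elim: s c => [|s IH] c; first by case: I_ideal.
by case=> c1 c2; split; [apply: IH|apply: kinD; [apply: kinZ|apply: kinN; apply: IH]].
Qed.

Lemma kin_y s y (c : koszul s) : I y -> kin I (y *: c).
Proof.
move=> Iy; elim: s c => [|s IH] c /=; last by split; apply: IH.
by rewrite /GRing.scale /= mulrC; case: I_ideal => _ _; apply.
Qed.

End Ideal.

Lemma kin_sub (I J : S -> Prop) s (c : koszul s) :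
  (forall a, I a -> J a) -> kin I c -> kin J c.
Proof.
by move=> IJ; elim: s c => [|s IH] c /=; [apply: IJ|case=> c1 c2; split; apply: IH].
Qed.

Lemma kin_split (I J : S -> Prop) y s p (c : koszul s) :
  ideal I -> (forall a, J a -> exists b, I (a - y * b)) ->
  kdeg p c -> kin J c -> exists b, kdeg p b /\ kin I (c - y *: b).
Proof.
move=> Ii JI; elim: s p c => [|s IH] p c /=.
  case=> [-> /JI [b Ib]|-> _]; first by exists b; split; [left|].
  by exists 0; split; [right|rewrite scaler0 subr0; case: Ii].
case=> c1 c2 [c1' c2']; have [b1 [b1p Ib1]] := IH _ _ c1 c1'.
case: p c2 c1 b1p => [c20|p /IH /(_ c2') [b2 [b2p Ib2]]] _ b1p; last by exists (b1, b2).
by exists (b1, 0); rewrite /= c20 scaler0 subr0; do !split=> //; apply: kin0.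
Qed.

(** * Vanishing of Koszul homology from a regular sequence *)

Section Vanishing.
Variables (U : S -> Prop) (s : nat) (I : nat -> S -> Prop) (y : nat -> S).
Hypothesis U1 : U 1.
Hypothesis UM : forall a b, U a -> U b -> U (a * b).
Hypothesis I_ideal : forall i, ideal (I i).
Hypothesis I0 : forall a, I 0%N a -> a = 0.
Hypothesis I_sub : forall i a, I i a -> I i.+1 a.
Hypothesis I_y : forall i, (i < s)%N -> I i.+1 (y i).
Hypothesis I_split : forall i a, (i < s)%N -> I i.+1 a -> exists b, I i (a - y i * b).
Hypothesis y_regular : forall i a, (i < s)%N -> I i (y i * a) -> I i a.
Hypothesis y_sat : forall i, (i < s)%N ->
  exists g (r : nat -> S), U g /\ g * y i = \sum_(j < s) r j * f j.

(* Multiplication by y i is null homotopic up to U, by [y_sat]; hence the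
   contraction of a cycle modulo I i is a cycle modulo I i.+1, one degree up,
   and a primitive of the latter gives one of the former. *)
Lemma koszul_acyclic i p (c : koszul s) : (i <= s)%N -> (i < p)%N ->
  kdeg p c -> kin (I i) (kdiff c) ->
  exists g b, [/\ U g, kdeg p.+1 b & kin (I i) (g *: c - kdiff b)].
Proof.
(* Descending induction on i: for i = s the degree p exceeds the number of generators, and c is
   zero. *)
move=> le_is; move: {2}(s - i)%N (leqnn (s - i)) => d.
elim: d => [|d IH] in i p c le_is *; rewrite ?leqn0 => di ip cp dc.
  have {di} -> : c = 0.
    apply: (kdeg_gt (p := p)) => //; apply: leq_ltn_trans ip.
    by rewrite -subn_eq0.
  exists 1, 0; split=> //; first exact: kdeg0.
  by rewrite kdiff0 scaler0 subr0; apply: kin0.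
case: (ltngtP i s) le_is => // [lt_is|eq_is] _; last first.
  by apply: IH; rewrite // eq_is // subnn.
have [g0 [r [Ug0 g0y]]] := y_sat lt_is.
have dhc : kdiff (kcontract r c) = (g0 * y i) *: c - kcontract r (kdiff c).
  by apply/eqP; rewrite g0y eq_sym subr_eq kcontract_homotopy.
have Ihdc := kin_contract (I_ideal i) r dc.
have [|//|||g1 [b1 [Ug1 b1p Ib1]]] := IH i.+1 p.+1 (kcontract r c) lt_is.
- by rewrite -ltnS -subSn ?subSS.
- exact: kdeg_contract.
- rewrite dhc; apply: kinD => //.
    by rewrite -scalerA; apply: kinZ => //; apply: kin_y => //; apply: I_y.
  by apply: kinN => //; apply: kin_sub Ihdc; apply: I_sub.
have [|b2 [b2p Ib2]] := kin_split (p := p.+1) (I_ideal i) (fun a => I_split lt_is (a := a)) _ Ib1.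
  apply: kdegD; first by apply: kdegZ; apply: kdeg_contract.
  by apply: kdegN; apply: kdeg_diff.
exists (g1 * g0), b2; split=> //; first exact: UM.
(* Applying [kdiff] to [g1 *: kcontract r c - kdiff b1 = y i *: b2], valid modulo I i, removes b1
   and leaves y i times the required congruence. Then y i is cancelled in each component. *)
have : kin (I i) (y i *: (g1 * g0 *: c - kdiff b2)).
  have := kinD (I_ideal i) (kin_diff (I_ideal i) Ib2) (kinZ (I_ideal i) g1 Ihdc).
  rewrite !(kdiffD, kdiffN, kdiffZ) kdiffK subr0 dhc.
  rewrite scalerBr addrAC subrK scalerBr !scalerA.
  by rewrite mulrA [g1 * g0 * _]mulrC.
elim: (s) (_ - _) => [|t IHt] e /=; first exact: y_regular.
by case=> e1 e2; split; apply: IHt.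
Qed.

End Vanishing.

(** The relation f_s a = sum q_j f_j is a 1-cycle with coefficients -q_j and a. Up to U it is a
    boundary, and the last coefficient of a boundary lies in the ideal of the other generators. *)
Lemma regular_last (U : S -> Prop) (s : nat) (I : nat -> S -> Prop) (y : nat -> S) :
  U 1 -> (forall a b, U a -> U b -> U (a * b)) ->
  (forall i, ideal (I i)) -> (forall a, I 0%N a -> a = 0) ->
  (forall i a, I i a -> I i.+1 a) -> (forall i, (i < s.+1)%N -> I i.+1 (y i)) ->
  (forall i a, (i < s.+1)%N -> I i.+1 a -> exists b, I i (a - y i * b)) ->
  (forall i a, (i < s.+1)%N -> I i (y i * a) -> I i a) ->
  (forall i, (i < s.+1)%N ->
     exists g (r : nat -> S), U g /\ g * y i = \sum_(j < s.+1) r j * f j) ->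
  forall a (q : nat -> S), f s * a = \sum_(j < s) q j * f j ->
  exists g (r : nat -> S), U g /\ g * a = \sum_(j < s) r j * f j.
Proof.
move=> U1 UM Ii I0 Is Iy Isp yr ys a q aq.
pose c : koszul s.+1 := (kchain1 s (fun i => - q i), kchain0 s a).
have cdeg : kdeg 1 c by split; [apply: kdeg_chain1|apply: kdeg_chain0].
have c0 : kdiff c = 0.
  rewrite /= [kdiff (kchain0 _ _)]kdiff_deg0; last exact: kdeg_chain0.
  rewrite kdiff_chain1 -kchain0Z aq -kchain0D -big_split /=.
  rewrite big1 => [|i _]; last by rewrite mulNr addNr.
  by have := kchain0Z s 0 0; rewrite mul0r scale0r oppr0 => ->.
have Idc : kin (I 0%N) (kdiff c) by rewrite c0; apply: kin0.
have [g [b [Ug bdeg Ib]]] :=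
  koszul_acyclic U1 UM Ii Is Iy Isp yr ys (leq0n _) (ltn0Sn _) cdeg Idc.
have gc : g *: c = kdiff b.
  apply/eqP; rewrite -subr_eq0; apply/eqP.
  elim: (s.+1) (_ - _) Ib => [|t IH] e /=; first exact: I0.
  by case: e => e1 e2 [/= /IH -> /IH ->].
case: b bdeg gc {Ib} => b1 b2 /= [_ /kdeg1P [r ->]] [_].
rewrite kdiff_chain1 => gb.
exists g, (fun i => - r i); split=> //; apply: (@kchain0_inj s).
under eq_bigr => i _ do rewrite mulNr.
by rewrite kchain0Z gb sumrN -[in RHS]mulN1r kchain0Z scaleN1r.
Qed.
End Koszul.

(** * Localized ideals of polynomials *)

Section MPolyAux.
Variables (K : fieldType) (n : nat).
Local Notation S := {mpoly K[n]}.

Lemma mpoly_ring_ind (P : S -> Prop) :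
  (forall c, P c%:MP) -> (forall i, P 'X_i) ->
  (forall f g, P f -> P g -> P (f + g)) ->
  (forall f g, P f -> P g -> P (f * g)) -> forall f, P f.
Proof.
move=> PC PX PD PM f; rewrite [f]mpolyE.
elim/big_ind: _ => [||m _] //; first exact: PC.
rewrite -mul_mpolyC; apply: (PM) => //; rewrite mpolyXE_id.
elim/big_ind: _ => [|f' g'|i _]; [by rewrite -mpolyC1|exact: PM|].
by elim: (m i) => [|k IH]; rewrite ?expr0 -?mpolyC1 // exprS; apply: PM.
Qed.

Lemma mpoly_rmorph_ext (T : comNzRingType) (phi psi : {rmorphism S -> T}) :
  (forall c, phi c%:MP = psi c%:MP) -> (forall i, phi 'X_i = psi 'X_i) -> phi =1 psi.
Proof.
move=> hC hX; apply: mpoly_ring_ind => // f g hf hg; first by rewrite !rmorphD hf hg.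
by rewrite !rmorphM hf hg.
Qed.

Lemma mcoeff_XM (k m : 'X_{1..n}) (p : S) :
  ('X_[k] * p)@_m = if (k <= m)%MM then p@_(m - k)%MM else 0.
Proof.
case: ifPn => km.
  by rewrite -[X in _@_X](submK km) addmC [_ * p]mulrC mcoeffMX.
apply: memN_msupp_eq0; apply: contra km.
rewrite mulrC (perm_mem (msuppMX _ _)) => /mapP[m' _ ->]; exact: lem_addr.
Qed.

Definition msubst n2 (h : 'I_n -> {mpoly K[n2]}) : S -> {mpoly K[n2]} :=
  mmap (@mpolyC n2 K) h.

HB.instance Definition _ n2 h := GRing.RMorphism.copy (@msubst n2 h) (mmap (@mpolyC n2 K) h).

Lemma msubstC n2 (h : 'I_n -> {mpoly K[n2]}) c : msubst h c%:MP = c%:MP.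
Proof. exact: mmapC. Qed.

Lemma msubstX n2 (h : 'I_n -> {mpoly K[n2]}) i : msubst h 'X_i = h i.
Proof. by rewrite /msubst mmapX mmap1U. Qed.

Lemma msubstZ n2 (h : 'I_n -> {mpoly K[n2]}) c f : msubst h (c *: f) = c *: msubst h f.
Proof. by rewrite -!mul_mpolyC rmorphM /= msubstC. Qed.

HB.instance Definition _ n2 h :=
  GRing.isScalable.Build K S {mpoly K[n2]} _ (@msubst n2 h) (fun c f => msubstZ h c f).

Lemma msubst_eval n2 (h : 'I_n -> {mpoly K[n2]}) v f :
  (msubst h f).@[v] = f.@[fun i => (h i).@[v]].
Proof.
apply: (mpoly_ring_ind (P := fun f => (msubst h f).@[v] = f.@[fun i => (h i).@[v]])).
- by move=> c; rewrite msubstC !mevalC.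
- by move=> i; rewrite msubstX mevalXU.
- by move=> p q hp hq; rewrite raddfD /= !mevalD hp hq.
- by move=> p q hp hq; rewrite rmorphM /= !mevalM hp hq.
Qed.

End MPolyAux.

Section Local.
Variables (K : fieldType) (n : nat).
Local Notation S := {mpoly K[n]}.
Implicit Types (J : S -> Prop) (x : 'I_n -> K).

(* The contraction to K[x_1, ..., x_n] of the extension J O_x. *)
Definition loc J x : S -> Prop := sat (fun g => g.@[x] != 0) J.

Lemma ideal_subspace J : ideal J -> subspace J.
Proof.
by case=> J0 JD JM; split=> // a u Ju; rewrite -mul_mpolyC; apply: JM.
Qed.

Lemma ideal_ideal_gen r (p : 'I_r -> S) : ideal (ideal_gen p).
Proof.
split.
- by exists (fun=> 0); rewrite big1 // => i _; rewrite mul0r.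
- move=> a b [q ->] [q' ->]; exists (fun i => q i + q' i).
  by rewrite -big_split; apply: eq_bigr => i _; rewrite mulrDl.
- move=> a b [q ->]; exists (fun i => a * q i).
  by rewrite mulr_sumr; apply: eq_bigr => i _; rewrite mulrA.
Qed.

Variable x : 'I_n -> K.

Lemma loc_ideal J : ideal J -> ideal (loc J x).
Proof.
case=> J0 JD JM; split.
- by exists 1; rewrite meval1 oner_neq0 mulr0.
- move=> a b [g [gx ga]] [h [hx hb]]; exists (g * h); split.
    by rewrite mevalM mulf_neq0.
  by rewrite mulrDr; apply: JD; [rewrite mulrAC mulrC|rewrite -mulrA]; apply: JM.
- move=> a b [g [gx gb]]; exists g; split=> //.
  by rewrite mulrCA; apply: JM.
Qed.

Lemma sub_loc J a : J a -> loc J x a.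
Proof. by exists 1; rewrite meval1 oner_neq0 mul1r. Qed.

Lemma loc_cancel J g a : g.@[x] != 0 -> loc J x (g * a) -> loc J x a.
Proof.
move=> gx [h [hx hga]]; exists (h * g); split; last by rewrite -mulrA.
by rewrite mevalM mulf_neq0.
Qed.

Lemma loc_mono J J' : (forall a, J a -> J' a) -> forall a, loc J x a -> loc J' x a.
Proof. by move=> JJ' a [g [gx /JJ' ga]]; exists g. Qed.

Section FiniteCodim.
Variables (J : S -> Prop) (M : nat).
Hypothesis J_ideal : ideal J.
Hypothesis JM : codim_le (loc J x) M.

Let locI := loc_ideal J_ideal.

(* Divide a linear relation between the powers of z by its lowest term. *)
Lemma power_relation z : exists k t, loc J x (z ^+ k * (1 - z * t)).
Proof.
have [a [[i0 ai0] Ja]] := JM (fun i => z ^+ i).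
pose b k := if insub k is Some i then a i else 0.
have bE (i : 'I_M.+1) : b i = a i by rewrite /b valK.
have exb : exists k, b k != 0 by exists i0; rewrite bE.
case: (ex_minnP exb) => k bk kmin.
exists k, (- (b k)^-1 *: \sum_(i < M.+1 | (k < i)%N) b i *: z ^+ (i - k.+1)).
have kM : (k < M.+1)%N by rewrite (leq_ltn_trans (kmin i0 _)) ?bE.
have := subspaceZ (ideal_subspace locI) (b k)^-1 Ja; congr (loc J x _).
rewrite (bigID (fun i : 'I_M.+1 => k < i)%N) /=.
rewrite [X in _ + X](bigD1 (Ordinal kM)) /=; last by rewrite ltnn.
rewrite [X in _ + (_ + X)]big1 ?addr0; last first.
  move=> i /andP[ki ik]; rewrite -bE.
  suff /eqP-> : b i == 0 by rewrite scale0r.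
  apply: contraT => /kmin; rewrite -leqNgt in ki.
  rewrite leq_eqVlt ltnNge ki orbF => /eqP e.
  by case/negP: ik; apply/eqP/val_inj.
rewrite -bE /= scalerDr scalerA mulVf // scale1r addrC mulrBr mulr1; congr (_ + _).
rewrite scaleNr mulrN mulrN opprK -!scalerAr; congr (_ *: _).
rewrite !mulr_sumr; apply: eq_bigr => i ki.
by rewrite -bE -!scalerAr -exprS -exprD -subSn // subSS subnKC // ltnW.
Qed.

(** In z^k (1 - z t) the second factor is a unit at x; in [loc_inverse] below it is the first
    one. *)
Lemma loc_nilpotent z : z.@[x] = 0 -> exists k, loc J x (z ^+ k).
Proof.
move=> zx; have [k [t]] := power_relation z; exists k.
apply: (loc_cancel (g := 1 - z * t)); last by rewrite mulrC.
by rewrite mevalB mevalM zx mul0r subr0 meval1 oner_neq0.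
Qed.

Lemma loc_inverse z : z.@[x] != 0 -> exists t, loc J x (1 - z * t).
Proof.
move=> zx; have [k [t]] := power_relation z => kt; exists t.
by apply: loc_cancel kt; rewrite rmorphXn expf_neq0.
Qed.

End FiniteCodim.
End Local.

(** * Powers of the local coordinates as a regular sequence *)

Section RegularSequence.
Variables (K : fieldType) (n : nat) (x : 'I_n.+1 -> K) (N : nat).
Local Notation S := {mpoly K[n.+1]}.

(** Moving x to the origin turns each [coord_power] into a monomial, so that membership, division
    and regularity are read off coefficients. *)
Definition translate (y : 'I_n.+1 -> K) : S -> S := msubst (fun i => 'X_i + (y i)%:MP).
HB.instance Definition _ y := GRing.LRMorphism.copy (translate y)
  (msubst (fun i => 'X_i + (y i)%:MP)).

Lemma translateK y : cancel (translate y) (translate (fun i => - y i)).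
Proof.
apply: (mpoly_rmorph_ext (phi := translate _ \o translate y) (psi := idfun)) => [c|i] /=.
  by rewrite /translate !msubstC.
by rewrite /translate msubstX rmorphD /= msubstX msubstC rmorphN /= subrK.
Qed.

Lemma translateK' y : cancel (translate (fun i => - y i)) (translate y).
Proof.
apply: (mpoly_rmorph_ext (phi := translate y \o translate _) (psi := idfun)) => [c|i] /=.
  by rewrite /translate !msubstC.
by rewrite /translate msubstX rmorphD /= msubstX msubstC rmorphN /= addrK.
Qed.

Definition low (i : nat) (m : 'X_{1..n.+1}) := forall j : 'I_n.+1, (j < i)%N -> (m j < N)%N.

(* The ideal generated by the first i of the [coord_power]s. *)
Definition cut_ideal (i : nat) (f : S) := forall m, low i m -> (translate x f)@_m = 0.

Definition coord_power (i : nat) : S := ('X_(inord i) - (x (inord i))%:MP) ^+ N.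

Lemma translate_coord_power i : translate x (coord_power i) = 'X_[U_(inord i) *+ N].
Proof.
by rewrite /coord_power rmorphXn rmorphB /= /translate msubstX msubstC addrK mpolyXn.
Qed.

Lemma cut_ideal_ideal i : ideal (cut_ideal i).
Proof.
split.
- by move=> m _; rewrite raddf0 mcoeff0.
- by move=> a b ha hb m mi; rewrite raddfD /= mcoeffD ha ?hb ?addr0.
- move=> a b hb m mi; rewrite rmorphM /= mcoeffM big1 // => k /eqP mk.
  rewrite hb ?mulr0 // => j ji; apply: leq_ltn_trans (mi j ji).
  have := congr1 (fun m' : 'X_{1..n.+1} => m' j) mk; rewrite mnmDE => ->.
  exact: leq_addl.
Qed.

Lemma cut_ideal0 f : cut_ideal 0 f -> f = 0.
Proof.
move=> f0; apply: (can_inj (translateK x)); rewrite raddf0.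
by apply/mpolyP => m; rewrite mcoeff0 f0.
Qed.

Lemma cut_ideal_sub i f : cut_ideal i f -> cut_ideal i.+1 f.
Proof. by move=> fi m mi; apply: fi => j ji; apply: mi; apply: ltnW. Qed.

Lemma cut_ideal_coord_power i : (i < n.+1)%N -> cut_ideal i.+1 (coord_power i).
Proof.
move=> i_n m mi; rewrite translate_coord_power mcoeffX; case: eqP => // mE.
have := mi (inord i); rewrite inordK // => /(_ (ltnSn _)).
by rewrite -mE mulmnE mnm1E eqxx mul1n ltnn.
Qed.

(** The coefficient of f at m is that of the product at m + N e_i, and [low i] puts no condition on
    the i-th exponent. *)
Lemma coord_power_regular i f : (i < n.+1)%N ->
  cut_ideal i (coord_power i * f) -> cut_ideal i f.
Proof.
move=> i_n fi m mi; set k := (U_(inord i) *+ N : 'X_{1..n.+1})%MM.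
have := fi (m + k)%MM; rewrite rmorphM /= translate_coord_power mcoeff_XM.
rewrite lem_addl addmK; apply => j ji.
rewrite mnmDE mulmnE mnm1E (_ : inord i == j = false) ?mul0n ?addn0 ?mi //.
by apply/eqP => ij; rewrite -ij inordK ?ltnn in ji.
Qed.

Lemma coord_power_split i f : (i < n.+1)%N ->
  cut_ideal i.+1 f -> exists g, cut_ideal i (f - coord_power i * g).
Proof.
move=> i_n fi; set T := translate x f.
(* The quotient by X_i^N, formed from the monomials divisible by it. *)
pose B := \sum_(m <- msupp T | (N <= m (inord i))%N)
  T@_m *: 'X_[m - U_(inord i) *+ N] : S.
exists (translate (fun i => - x i) B) => m mi.
rewrite raddfB /= rmorphM /= translateK' translate_coord_power -/T.
have -> : T - 'X_[U_(inord i) *+ N] * B =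
    \sum_(m <- msupp T | (m (inord i) < N)%N) T@_m *: 'X_[m].
  apply/eqP; rewrite subr_eq addrC [T in T == _]mpolyE.
  rewrite (bigID (fun m : 'X_{1..n.+1} => N <= m (inord i))%N) /=; apply/eqP; congr (_ + _).
    rewrite mulr_sumr; apply: eq_bigr => k Nk.
    rewrite -scalerAr -mpolyXD addmC submK //; apply/mnm_lepP => j.
    by rewrite mulmnE mnm1E; case: eqP => [<-|_]; rewrite ?mul1n ?mul0n.
  by apply: eq_bigl => k; rewrite -ltnNge.
rewrite raddf_sum /= big1 // => k kN; rewrite mcoeffZ mcoeffX.
case: eqP => [km|_]; last by rewrite mulr0.
rewrite km in kN *; rewrite fi ?mul0r // => j.
rewrite ltnS leq_eqVlt => /orP[/eqP ji|/mi//].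
by rewrite (_ : j = inord i) //; apply: val_inj; rewrite /= inordK.
Qed.

End RegularSequence.

(** * Unmixedness for a system of parameters *)

Section Unmixed.
Variables (K : fieldType) (n : nat) (x : 'I_n.+1 -> K).
Local Notation S := {mpoly K[n.+1]}.

Definition gen (s : nat) (p : nat -> S) (f : S) :=
  exists q : nat -> S, f = \sum_(i < s) q i * p i.

Lemma ideal_gen_nat s p : ideal (gen s p).
Proof.
split.
- by exists (fun=> 0); rewrite big1 // => i _; rewrite mul0r.
- move=> a b [q ->] [q' ->]; exists (fun i => q i + q' i).
  by rewrite -big_split; apply: eq_bigr => i _; rewrite mulrDl.
- move=> a b [q ->]; exists (fun i => a * q i).
  by rewrite mulr_sumr; apply: eq_bigr => i _; rewrite mulrA.
Qed.

(* The n.+1 elements p_0, ..., p_n form a system of parameters at x. *)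
Lemma loc_unmixed (p : nat -> S) M a :
  codim_le (loc (gen n.+1 p) x) M ->
  loc (gen n p) x (p n * a) -> loc (gen n p) x a.
Proof.
move=> pM [g [gx [q gq]]].
have Ii := ideal_gen_nat n.+1 p.
have /fin_all_exists[k nilp] (i : 'I_n.+1) :
    exists k, loc (gen n.+1 p) x (('X_i - (x i)%:MP) ^+ k).
  by apply: (loc_nilpotent Ii pM); rewrite mevalB mevalXU mevalC subrr.
(* With one exponent for all coordinates, the N-th powers of the X_i - x_i form a regular sequence
   in the localized ideal, of the same length as p_0, ..., p_n. *)
pose N := \max_i k i.
have ys i : (i < n.+1)%N -> exists g (r : nat -> S),
    g.@[x] != 0 /\ g * coord_power x N i = \sum_(j < n.+1) r j * p j.
  move=> _; have [_ _ JM] := loc_ideal x Ii.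
  have := JM (('X_(inord i) - (x (inord i))%:MP) ^+ (N - k (inord i))) _ (nilp (inord i)).
  by rewrite -exprD subnK ?leq_bigmax // => -[h [hx [r hr]]]; exists h, r.
have [|||||||||h [r [hx hr]]] := @regular_last _ p (fun g => g.@[x] != 0) n
  (cut_ideal x N) (coord_power x N) _ _ _ _ _ _ _ _ ys (g * a) q.
- by rewrite meval1 oner_neq0.
- by move=> b c bx cx; rewrite mevalM mulf_neq0.
- exact: cut_ideal_ideal.
- exact: cut_ideal0.
- exact: cut_ideal_sub.
- exact: cut_ideal_coord_power.
- by move=> i b i_n; apply: coord_power_split.
- by move=> i b i_n; apply: coord_power_regular.
- by rewrite mulrCA.
exists (h * g); split; first by rewrite mevalM mulf_neq0.
by exists r; rewrite -mulrA.
Qed.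

End Unmixed.

(** * Additivity and transfer of multiplicities *)

Section Additivity.
Variables (K : fieldType) (n : nat) (x : 'I_n -> K).
Local Notation S := {mpoly K[n]}.
Implicit Types (I : S -> Prop).

Definition adjoin I (g f : S) := exists h, I (f - h * g).

Lemma adjoin_ideal I g : ideal I -> ideal (adjoin I g).
Proof.
case=> I0 ID IM; split.
- by exists 0; rewrite mul0r subr0.
- by move=> a b [h ha] [k kb]; exists (h + k); rewrite mulrDl opprD addrACA; apply: ID.
- by move=> a b [k kb]; exists (a * k); rewrite -mulrA -mulrBr; apply: IM.
Qed.

Lemma adjoin_gen I g : ideal I -> adjoin I g g.
Proof. by case=> I0 _ _; exists 1; rewrite mul1r subrr. Qed.

Lemma adjoin_sub I g f : I f -> adjoin I g f.
Proof. by exists 0; rewrite mul0r subr0. Qed.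

Definition regular_mod I g := forall a, loc I x (g * a) -> loc I x a.

(** With O the local ring at x, multiplication by g gives an exact sequence 0 -> O/(I,h) -> O/(I,gh)
    -> O/(I,g) -> 0; its injectivity is the regularity of g modulo I. *)
Lemma codim_mul I g h a b : ideal I -> regular_mod I g ->
  codim (loc (adjoin I g) x) a -> codim (loc (adjoin I h) x) b ->
  codim (loc (adjoin I (g * h)) x) (a + b).
Proof.
move=> II g_reg Ca Cb; have [e [Se De]] := Ca; have [e' [Se' De']] := Cb.
have Ig := adjoin_ideal g II; have Ih := adjoin_ideal h II.
have Igh := adjoin_ideal (g * h) II.
have [[Lg Lh] Lgh] := (loc_ideal x Ig, loc_ideal x Ih, loc_ideal x Igh).
have [[Sg Sh] Sgh] := (ideal_subspace Lg, ideal_subspace Lh, ideal_subspace Lgh).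
have mulgh f : loc (adjoin I h) x f -> loc (adjoin I (g * h)) x (g * f).
  case=> v [vx [k Ik]]; exists v; split=> //; exists k.
  have [_ _ /(_ g _ Ik)] := II; congr I.
  by rewrite mulrBr mulrCA [k * (g * h)]mulrCA.
(* Only v f is a multiple of g modulo I. As g sends (I,h) into (I,gh), an inverse t of v modulo the
   localized (I,h) suffices to divide by v. *)
have lift f : loc (adjoin I g) x f -> exists t, loc (adjoin I (g * h)) x (f - g * t).
  case=> v [vx [k Ik]].
  have [t vt] := loc_inverse Ih (codim_codim_le (ideal_subspace Lh) Cb) vx.
  exists (k * t); apply: (loc_cancel vx).
  have -> : v * (f - g * (k * t)) = (v * f - k * g) + k * (g * (1 - v * t)) by ring.
  apply: (subspaceD Sgh).
    by apply: sub_loc; apply: adjoin_sub.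
  by case: Lgh => _ _; apply; apply: mulgh.
have sumE (d : 'I_b -> K) : \sum_j d j *: (g * e' j) = g * \sum_j d j *: e' j.
  by rewrite mulr_sumr; apply: eq_bigr => j _; rewrite scalerAr.
rewrite -[(a + b)%N](_ : #|{: 'I_a + 'I_b}| = _); last by rewrite card_sum !card_ord.
apply: (codim_card (e := fun i => match i with inl i => e i | inr j => g * e' j end)).
  move=> z; have [c zc] := Se z; have [t zt] := lift _ zc; have [d td] := Se' t.
  exists (fun i => match i with inl i => c i | inr j => d j end).
  rewrite big_sumType /= opprD addrA; apply: (subspace_trans Sgh zt).
  by have := mulgh _ td; rewrite mulrBr sumE.
move=> c; rewrite big_sumType /= => cz.
have ghg f : loc (adjoin I (g * h)) x f -> loc (adjoin I g) x f.
  apply: loc_mono => {}f [k Ik]; exists (k * h).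
  by rewrite -mulrA [h * g]mulrC.
have gL f : loc (adjoin I g) x (g * f).
  by apply: sub_loc; exists f; rewrite mulrC subrr; case: II.
have c0 i : c (inl i) = 0.
  apply: (De (fun i => c (inl i))).
  have := subspaceB Sg (ghg _ cz) (gL (\sum_(j < b) c (inr j) *: e' j)).
  by rewrite sumE addrK.
move: cz; rewrite big1 => [|i _]; last by rewrite c0 scale0r.
rewrite add0r sumE => -[v [vx [k Ik]]].
case=> // j; apply: (De' (fun j => c (inr j))).
have /g_reg : loc I x (g * (v * \sum_(j < b) c (inr j) *: e' j - k * h)).
  by apply: sub_loc; congr I: Ik; ring.
move=> [w [wx Iw]]; apply: (loc_cancel vx); exists w; split=> //.
by exists (w * k); congr I: Iw; ring.
Qed.

Lemma codim_prod I (T : Type) (r : seq T) (g : T -> S) M : ideal I ->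
  (forall t, regular_mod I (g t)) ->
  (forall t, codim (loc (adjoin I (g t)) x) M) ->
  codim (loc (adjoin I (\prod_(t <- r) g t)) x) (size r * M).
Proof.
move=> II greg gM; elim: r => [|t r IH] /=.
  exists (fun=> 0); split=> [z|a _ []//].
  exists (fun=> 0); rewrite big_ord0 subr0; apply: sub_loc.
  by exists z; rewrite big_nil mulr1 subrr; case: II.
by rewrite big_cons mulSn; apply: codim_mul.
Qed.

End Additivity.

Lemma rmorph_cong (K : fieldType) n (T : comNzRingType) (I : T -> Prop)
    (phi psi : {rmorphism {mpoly K[n]} -> T}) :
  ideal I -> (forall c, phi c%:MP = psi c%:MP) ->
  (forall i, I (phi 'X_i - psi 'X_i)) -> forall f, I (phi f - psi f).
Proof.
move=> [I0 ID IM] hC hX; apply: mpoly_ring_ind => // [c|f g hf hg|f g hf hg].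
- by rewrite hC subrr.
- by rewrite !rmorphD opprD addrACA; apply: ID.
- rewrite !rmorphM (_ : _ - _ = phi g * (phi f - psi f) + psi f * (phi g - psi g)).
    by apply: ID; apply: IM.
  by ring.
Qed.

Section Transfer.
Variables (K : fieldType) (n1 n2 : nat).
Variables (h1 : 'I_n1 -> {mpoly K[n2]}) (h2 : 'I_n2 -> {mpoly K[n1]}).
Variables (x1 : 'I_n1 -> K) (x2 : 'I_n2 -> K).
Variables (J1 : {mpoly K[n1]} -> Prop) (J2 : {mpoly K[n2]} -> Prop).
Let phi := msubst h1.
Let psi := msubst h2.
Hypothesis (J1_ideal : ideal J1) (J2_ideal : ideal J2).
Hypothesis h1x : forall i, (h1 i).@[x2] = x1 i.
Hypothesis h2x : forall i, (h2 i).@[x1] = x2 i.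
Hypothesis phiJ : forall f, J1 f -> loc J2 x2 (phi f).
Hypothesis psiJ : forall f, J2 f -> loc J1 x1 (psi f).
Hypothesis psi_phi : forall i, loc J1 x1 (psi (h1 i) - 'X_i).
Hypothesis phi_psi : forall i, loc J2 x2 (phi (h2 i) - 'X_i).

Lemma loc_msubst n m (h : 'I_n -> {mpoly K[m]}) x y J J' f :
  (forall i, (h i).@[y] = x i) -> (forall f, J f -> loc J' y (msubst h f)) ->
  loc J x f -> loc J' y (msubst h f).
Proof.
move=> hx hJ [g [gx /hJ]]; rewrite rmorphM /=; apply: loc_cancel.
by rewrite msubst_eval (meval_eq _ hx).
Qed.

(** Substitutions inverse to each other modulo the localized ideals induce an isomorphism of the
    quotients. The hypotheses are symmetric, so the converse follows by exchanging the two sides. *)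
Lemma codim_transfer N : codim (loc J1 x1) N -> codim (loc J2 x2) N.
Proof.
case=> e [Se De]; exists (fun i => phi (e i)).
have [L1 L2] := (loc_ideal x1 J1_ideal, loc_ideal x2 J2_ideal).
have [S1 S2] := (ideal_subspace L1, ideal_subspace L2).
have pp f : loc J1 x1 (psi (phi f) - f).
  apply: (rmorph_cong (phi := psi \o phi) (psi := idfun)) => // [c|i] /=.
    by rewrite /phi /psi !msubstC.
  by rewrite [msubst h1 _]msubstX; apply: psi_phi.
have pp' f : loc J2 x2 (phi (psi f) - f).
  apply: (rmorph_cong (phi := phi \o psi) (psi := idfun)) => // [c|i] /=.
    by rewrite /phi /psi !msubstC.
  by rewrite [msubst h2 _]msubstX; apply: phi_psi.
have sumE (a : 'I_N -> K) : \sum_i a i *: phi (e i) = phi (\sum_i a i *: e i).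
  by rewrite /phi linear_sum; apply: eq_bigr => i _; rewrite linearZ.
split=> [z|a].
  have [a za] := Se (psi z); exists a; rewrite sumE.
  apply: (subspace_trans S2 (v := phi (psi z))).
    by rewrite -opprB; apply: subspaceN.
  by rewrite /phi -raddfB; apply: loc_msubst za.
rewrite sumE => az; apply: De; move: (\sum_i a i *: e i) az => f az.
have {}az : loc J1 x1 (psi (phi f)) by apply: loc_msubst h2x psiJ az.
have := subspaceB S1 az (pp f).
have -> : psi (phi f) - (psi (phi f) - f) = f by ring.
exact.
Qed.

End Transfer.

(** * Smooth points of the cusp y^l = x^m *)

Section Congruence.
Variables (S : comNzRingType) (I : S -> Prop).
Hypothesis I_ideal : ideal I.

Lemma idealM a b : I b -> I (a * b). Proof. by case: I_ideal => _ _; apply. Qed.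
Lemma idealD a b : I a -> I b -> I (a + b). Proof. by case: I_ideal => _ + _; apply. Qed.
Lemma idealN a : I a -> I (- a). Proof. by rewrite -mulN1r; apply: idealM. Qed.

Lemma ideal_trans b a c : I (a - b) -> I (b - c) -> I (a - c).
Proof. by move=> ab /(idealD ab); rewrite addrA subrK. Qed.

Lemma ideal_congM a b c d : I (a - b) -> I (c - d) -> I (a * c - b * d).
Proof.
move=> ab cd; have -> : a * c - b * d = c * (a - b) + b * (c - d) by ring.
by apply: idealD; apply: idealM.
Qed.

Lemma ideal_congX a b k : I (a - b) -> I (a ^+ k - b ^+ k).
Proof. by move=> ab; rewrite subrXX mulrC; apply: idealM. Qed.

Lemma ideal_refl a : I (a - a). Proof. by rewrite subrr; case: I_ideal. Qed.

Lemma ideal_mem a b : I (a - b) -> I b -> I a.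
Proof. by move=> ab /(idealD ab); rewrite subrK. Qed.

End Congruence.

Section Cusp.
Variables (K : fieldType) (n l m : nat).
Local Notation S := {mpoly K[n.+2]}.
Local Notation B := {mpoly K[n.+1]}.
Local Notation X := ('X_(penult n) : S).
Local Notation Y := ('X_ord_max : S).

Definition cusp_var (i : 'I_n.+2) : B :=
  match unlift ord_max i with
  | None => 'X_ord_max ^+ m
  | Some j => if j == ord_max then 'X_ord_max ^+ l else 'X_j
  end.

Definition cusp_eq : S := Y ^+ l - X ^+ m.

Lemma cusp_var_max : cusp_var ord_max = 'X_ord_max ^+ m.
Proof. by rewrite /cusp_var unlift_none. Qed.

Lemma cusp_var_penult : cusp_var (penult n) = 'X_ord_max ^+ l.
Proof. by rewrite /cusp_var liftK eqxx. Qed.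

Lemma cusp_var_lift j : j != ord_max -> cusp_var (lift ord_max j) = 'X_j.
Proof. by rewrite /cusp_var liftK => /negbTE ->. Qed.

Lemma cusp_eq_subst : msubst cusp_var cusp_eq = 0.
Proof.
rewrite /cusp_eq rmorphB !rmorphXn /= !msubstX cusp_var_max cusp_var_penult.
by rewrite -!exprM mulnC subrr.
Qed.

Lemma index_cases (P : 'I_n.+2 -> Prop) :
  P ord_max -> P (penult n) -> (forall j, j != ord_max -> P (lift ord_max j)) ->
  forall i, P i.
Proof.
move=> Pm Pp Pl i; case: (unliftP ord_max i) => [j|] -> //.
by case: (eqVneq j ord_max) => [->|/Pl].
Qed.

Variable f : 'I_n.+1 -> S.
Definition cusp_ideal : S -> Prop := adjoin (ideal_gen f) cusp_eq.
Definition param_ideal : B -> Prop := ideal_gen (fun j => msubst cusp_var (f j)).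

Lemma cusp_ideal_ideal : ideal cusp_ideal.
Proof. exact/adjoin_ideal/ideal_ideal_gen. Qed.

Lemma param_ideal_ideal : ideal param_ideal.
Proof. exact: ideal_ideal_gen. Qed.

Lemma cusp_param g : cusp_ideal g -> param_ideal (msubst cusp_var g).
Proof.
case=> h [q gh]; exists (fun j => msubst cusp_var (q j)).
have /(congr1 (msubst cusp_var)) := gh; rewrite rmorphB rmorphM /= cusp_eq_subst mulr0 subr0 => ->.
by rewrite raddf_sum /=; apply: eq_bigr => j _; rewrite rmorphM.
Qed.

Lemma cusp_ideal_gen j : cusp_ideal (f j).
Proof.
apply: adjoin_sub; exists (fun i => (i == j)%:R).
rewrite (bigD1 j) //= eqxx mul1r big1 ?addr0 // => i /negbTE ->; exact: mul0r.
Qed.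

Variable u : 'I_n.+1 -> K.
Definition cusp_point (i : 'I_n.+2) : K := (cusp_var i).@[u].

Section Smooth.
Hypothesis u0 : u ord_max != 0.
Variables (a b : nat).
Hypothesis ab : (a * l = b * m + 1)%N.

Let y0 := u ord_max ^+ m.
Let y0_neq0 : y0 != 0. Proof. exact: expf_neq0. Qed.
Let w : S := 1 - y0^-1 *: Y.
(* An inverse of Y modulo w ^+ M. *)
Let s (M : nat) : S := y0^-1 *: \sum_(k < M) w ^+ k.

Let Ys M : 1 - Y * s M = w ^+ M.
Proof.
have -> : Y * s M = (1 - w) * \sum_(k < M) w ^+ k.
  by rewrite /w subKr /s -scalerAr scalerAl.
have -> : w ^+ M = 1 + (w - 1) * \sum_(k < M) w ^+ k by rewrite -subrX1 addrC subrK.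
ring.
Qed.

Let w_point : w.@[cusp_point] = 0.
Proof.
rewrite /w mevalB mevalZ mevalXU /cusp_point cusp_var_max rmorphXn /= mevalXU.
by rewrite meval1 mulVf // subrr.
Qed.

(** The inverse u = x^a / y^b of the parametrization, with [s M] in place of 1/y so that it is a
    polynomial substitution. *)
Let uncusp M (j : 'I_n.+1) : S :=
  if j == ord_max then X ^+ a * s M ^+ b else 'X_(lift ord_max j).

(** Modulo I, X^m = Y^l and Y s = 1, whence X^(am) s^(bm) = Y^(al) s^(bm) = Y and X^(al) s^(bl) = X
    Y^(bl) s^(bl) = X. *)
Let uncusp_cusp (I : S -> Prop) M i : ideal I -> I cusp_eq -> I (w ^+ M) ->
  I (msubst (uncusp M) (cusp_var i) - 'X_i).
Proof.
move=> II Ie; rewrite -(Ys M) => Is.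
have {}Is : I (Y * s M - 1) by rewrite -opprB; apply: idealN.
have Is1 k : I ((Y * s M) ^+ k - 1) by have := ideal_congX II k Is; rewrite expr1n.
have IXY k : I (X ^+ (m * k) - Y ^+ (l * k)).
  by rewrite !exprM; apply: ideal_congX => //; rewrite -opprB; apply: idealN.
elim/index_cases: i => [||j jm].
- rewrite cusp_var_max rmorphXn /= msubstX /uncusp eqxx exprMn -!exprM.
  rewrite mulnC; apply: (ideal_trans II (b := Y ^+ (l * a) * s M ^+ (b * m))).
    by apply: ideal_congM => //; apply: ideal_refl.
  rewrite mulnC ab addn1 exprS -mulrA -exprMn -[X in _ - X]mulr1.
  by apply: ideal_congM => //; apply: ideal_refl.
- rewrite cusp_var_penult rmorphXn /= msubstX /uncusp eqxx exprMn -!exprM.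
  rewrite ab addn1 exprS -mulrA -[X in _ - X]mulr1; apply: ideal_congM => //.
    exact: ideal_refl.
  apply: (ideal_trans II (b := Y ^+ (l * b) * s M ^+ (b * l))).
    by rewrite [(b * m)%N]mulnC; apply: ideal_congM => //; apply: ideal_refl.
  by rewrite [(l * b)%N]mulnC -exprMn.
- by rewrite cusp_var_lift // msubstX /uncusp (negbTE jm); apply: ideal_refl.
Qed.

Let cusp_uncusp (I : B -> Prop) M j : ideal I -> I (msubst cusp_var (w ^+ M)) ->
  I (msubst cusp_var (uncusp M j) - 'X_j).
Proof.
move=> II; rewrite -(Ys M) rmorphB rmorphM rmorph1 /= msubstX cusp_var_max => Is.
rewrite /uncusp; case: eqP => [->|/eqP jm]; last first.
  by rewrite msubstX cusp_var_lift //; apply: ideal_refl.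
rewrite rmorphM !rmorphXn /= msubstX cusp_var_penult -!exprM mulnC ab addn1.
rewrite exprS -mulrA mulnC exprM -exprMn -[X in _ - X]mulr1.
apply: ideal_congM => //; first exact: ideal_refl.
rewrite -[X in _ - X](expr1n _ b); apply: ideal_congX => //.
by rewrite -opprB; apply: idealN.
Qed.

(** The index is a successor because w^0 = 1 does not vanish at the point. *)
Let s_point M : (s M.+1).@[cusp_point] = y0^-1.
Proof.
have := congr1 (meval cusp_point) (Ys M.+1).
rewrite mevalB meval1 mevalM mevalXU rmorphXn /= w_point expr0n /=.
rewrite /cusp_point cusp_var_max rmorphXn /= mevalXU -/y0 => /eqP.
by rewrite subr_eq0 => /eqP sE; apply: (mulfI y0_neq0); rewrite -sE mulfV.
Qed.

Let uncusp_point M j : (uncusp M.+1 j).@[cusp_point] = u j.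
Proof.
rewrite /uncusp; case: eqP => [->|/eqP jm]; last first.
  by rewrite mevalXU /cusp_point cusp_var_lift // mevalXU.
rewrite mevalM !rmorphXn /= s_point mevalXU /cusp_point cusp_var_penult.
rewrite rmorphXn /= mevalXU -exprM mulnC ab addn1 exprS exprVn -exprM mulnC.
by rewrite mulfK // expf_neq0.
Qed.

(** A general J serves both for [cusp_ideal] and, in [nilp_cusp], for its sum with a power of w. *)
Let uncusp_gen J M g : ideal J -> (forall h, cusp_ideal h -> J h) ->
  loc J cusp_point (w ^+ M) -> param_ideal g ->
  loc J cusp_point (msubst (uncusp M) g).
Proof.
move=> JI Jc Jw [q ->].
have LI := loc_ideal cusp_point JI.
rewrite raddf_sum /=; apply: (subspace_sum (ideal_subspace LI)) => j _.
rewrite rmorphM /=; apply: (idealM LI); apply: (ideal_mem LI (b := f j)); last first.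
  by apply: sub_loc; apply: Jc; apply: cusp_ideal_gen.
apply: (rmorph_cong (phi := msubst (uncusp M) \o msubst cusp_var) (psi := idfun)) => //= [c|i].
  by rewrite !msubstC.
rewrite [msubst cusp_var _]msubstX; apply: uncusp_cusp => //.
by apply: sub_loc; apply: Jc; apply: adjoin_gen; apply: ideal_ideal_gen.
Qed.

(* The substitution [uncusp] is only defined modulo a power of w; modulo
   w ^+ M.+1 it shows that w ^+ M is a multiple of w ^+ M.+1, and Nakayama's
   lemma applies. *)
Let nilp_cusp M : loc param_ideal u (msubst cusp_var (w ^+ M)) ->
  loc cusp_ideal cusp_point (w ^+ M).
Proof.
move=> Bw; pose J := adjoin cusp_ideal (w ^+ M.+1).
have JI : ideal J := adjoin_ideal _ cusp_ideal_ideal.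
have LI := loc_ideal cusp_point JI.
have Jc h : cusp_ideal h -> J h by apply: adjoin_sub.
have Jw : loc J cusp_point (w ^+ M.+1) by apply: sub_loc; apply: adjoin_gen cusp_ideal_ideal.
have {}Bw : loc J cusp_point (msubst (uncusp M.+1) (msubst cusp_var (w ^+ M))).
  apply: loc_msubst Bw; first exact: uncusp_point.
  by move=> g; apply: uncusp_gen.
have : loc J cusp_point (w ^+ M).
  apply: (ideal_mem LI _ Bw); rewrite -opprB; apply: (idealN LI).
  apply: (rmorph_cong (phi := msubst (uncusp M.+1) \o msubst cusp_var) (psi := idfun)) => //= [c|i].
    by rewrite !msubstC.
  rewrite [msubst cusp_var _]msubstX; apply: uncusp_cusp => //.
  by apply: sub_loc; apply: Jc; apply: adjoin_gen; apply: ideal_ideal_gen.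
(* The relation v w^M = k w^(M+1) modulo the cusp ideal reads (v - k w) w^M = 0, where v - k w is a
   unit at the point. *)
move=> [v [vx [k Jk]]]; apply: (loc_cancel (g := v - k * w)).
  by rewrite mevalB mevalM w_point mulr0 subr0.
by apply: sub_loc; congr cusp_ideal: Jk; rewrite exprS; ring.
Qed.

(** Finite dimension makes w nilpotent on the side where it is assumed; from the parametric side
    [nilp_cusp] brings this back to the cusp. Then [uncusp] and [cusp_var] are inverse to each
    other. *)
Lemma smooth_codim N :
  codim (loc cusp_ideal cusp_point) N <-> codim (loc param_ideal u) N.
Proof.
have [IS IB] := (cusp_ideal_ideal, param_ideal_ideal).
have [LS LB] := (loc_ideal cusp_point IS, loc_ideal u IB).
have main M : loc cusp_ideal cusp_point (w ^+ M.+1) ->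
  codim (loc cusp_ideal cusp_point) N <-> codim (loc param_ideal u) N.
  move=> wM.
  have wB : loc param_ideal u (msubst cusp_var (w ^+ M.+1)).
    apply: loc_msubst wM => // g gc; exact/sub_loc/cusp_param.
  have Ie : loc cusp_ideal cusp_point cusp_eq.
    by apply: sub_loc; apply: adjoin_gen; apply: ideal_ideal_gen.
  have cp i : (cusp_var i).@[u] = cusp_point i by [].
  have c_loc g : cusp_ideal g -> loc param_ideal u (msubst cusp_var g).
    by move=> gc; exact/sub_loc/cusp_param.
  have p_loc g : param_ideal g -> loc cusp_ideal cusp_point (msubst (uncusp M.+1) g).
    exact: uncusp_gen.
  have uc i : loc cusp_ideal cusp_point (msubst (uncusp M.+1) (cusp_var i) - 'X_i).
    exact: uncusp_cusp.
  have cu j : loc param_ideal u (msubst cusp_var (uncusp M.+1 j) - 'X_j).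
    exact: cusp_uncusp.
  split.
    exact: (codim_transfer IS IB cp (uncusp_point M) c_loc p_loc uc cu).
  exact: (codim_transfer IB IS (uncusp_point M) cp p_loc c_loc cu uc).
have up k M g (J : {mpoly K[k]} -> Prop) x : ideal J -> loc J x (g ^+ M) -> loc J x (g ^+ M.+1).
  by move=> JI gM; rewrite exprS; apply: (idealM (loc_ideal x JI)).
split=> C.
  have [M wM] := loc_nilpotent IS (codim_codim_le (ideal_subspace LS) C) w_point.
  by apply/(main M) => //; apply: up.
have [|M wM] := loc_nilpotent (z := msubst cusp_var w) IB (codim_codim_le (ideal_subspace LB) C).
  by rewrite msubst_eval w_point.
by apply/(main M) => //; apply: up => //; apply: nilp_cusp; rewrite rmorphXn.
Qed.

End Smooth.
End Cusp.

(** * The cyclic cover x = X^l *)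

(** The factorization of t^l - 1, evaluated at t = Y/Z in the fraction field and multiplied by
    Z^l. *)
Lemma prod_sub_unity_root (K : fieldType) (S : idomainType) (e : {rmorphism K -> S})
    (l : nat) (z : K) (Y Z : S) :
  l.-primitive_root z -> Z != 0 ->
  \prod_(i < l) (Y - e (z ^+ i) * Z) = Y ^+ l - Z ^+ l.
Proof.
move=> zl Z0; apply/eqP; rewrite -tofrac_eq; apply/eqP.
have Zf0 : tofrac Z != 0 by rewrite tofrac_eq0.
pose t := tofrac Y / tofrac Z; pose F : {rmorphism K -> {fraction S}} := @tofrac S \o e.
have := congr1 (fun p => (map_poly F p).[t]) (factor_Xn_sub_1 zl).
rewrite rmorph_prod horner_prod rmorphB rmorph1 /= map_polyXn !hornerE.
rewrite big_mkord => /(congr1 (fun v => v * tofrac Z ^+ l)).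
rewrite mulrBl mul1r expr_div_n divfK ?expf_neq0 // tofracB !tofracXn => <-.
have -> : tofrac Z ^+ l = \prod_(i < l) tofrac Z by rewrite prodr_const card_ord.
rewrite rmorph_prod -big_split /=.
apply: eq_bigr => i _; rewrite [map_poly _ _]rmorphB /= map_polyX map_polyC /= !hornerE.
by rewrite mulrBl divfK // tofracB tofracM.
Qed.

Section LinearExtension.
Variables (K : fieldType) (n : nat) (V : lmodType K) (F : 'X_{1..n} -> V).
Local Notation S := {mpoly K[n]}.

Definition lin_ext (p : S) : V := \sum_(m <- msupp p) p@_m *: F m.

Lemma lin_extE k p : (msize p <= k)%N -> lin_ext p = \sum_(m : 'X_{1..n < k}) p@_m *: F m.
Proof.
move=> lt_pk; pose I : subFinType _ := 'X_{1..n < k}.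
rewrite /lin_ext (big_mksub I) //=; first last.
- by move=> x /msize_mdeg_lt /leq_trans; apply.
- by rewrite msupp_uniq.
by rewrite big_rmcond //= => i; move/memN_msupp_eq0 ->; rewrite scale0r.
Qed.

Lemma lin_ext_is_linear : linear lin_ext.
Proof.
move=> a p q; pose k := maxn (msize p) (maxn (msize q) (msize (a *: p + q))).
rewrite !(lin_extE (k := k)) ?leq_max ?leqnn ?orbT // scaler_sumr -big_split.
by apply: eq_bigr => m _; rewrite mcoeffD mcoeffZ scalerDl scalerA.
Qed.

HB.instance Definition _ := GRing.isLinear.Build K S V _ lin_ext lin_ext_is_linear.

Lemma lin_extX m : lin_ext 'X_[m] = F m.
Proof. by rewrite /lin_ext msuppX big_seq1 mcoeffX eqxx scale1r. Qed.

End LinearExtension.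

Lemma mpoly_linear_ind (K : fieldType) n (P : {mpoly K[n]} -> Prop) :
  P 0 -> (forall a f g, P f -> P g -> P (a *: f + g)) ->
  (forall m, P 'X_[m]) -> forall f, P f.
Proof. by move=> P0 PD PX; elim/mpolyind=> // c m f _ _; apply: PD. Qed.

Section Cover.
Variables (K : fieldType) (n l : nat) (i0 : 'I_n) (z : K).
Hypothesis l_gt0 : (0 < l)%N.
Hypothesis zl : l.-primitive_root z.
Local Notation S := {mpoly K[n]}.

Definition cover : S -> S := msubst (fun i => if i == i0 then 'X_i ^+ l else 'X_i).
HB.instance Definition _ := GRing.LRMorphism.copy cover
  (msubst (fun i => if i == i0 then 'X_i ^+ l else 'X_i)).

Definition mdivn (m : 'X_{1..n}) : 'X_{1..n} :=
  [multinom if i == i0 then m i %/ l else m i | i < n]%N.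

(* The coefficient of 'X_i0 ^+ k (k < l) in the basis of powers of 'X_i0 over
   the image of [cover]. *)
Definition component (k : nat) : S -> S :=
  lin_ext (fun m => if (m i0 %% l == k)%N then 'X_[mdivn m] else 0).
HB.instance Definition _ k := GRing.Linear.copy (component k)
  (lin_ext (fun m => if (m i0 %% l == k)%N then 'X_[mdivn m] else 0)).

Lemma componentX k m : component k 'X_[m] = if (m i0 %% l == k)%N then 'X_[mdivn m] else 0.
Proof. exact: lin_extX. Qed.

(** Multiplying by X_i0^l keeps the remainder of the exponent of X_i0 modulo l and raises its
    quotient by one. *)
Lemma component_cover k a b : component k (cover a * b) = a * component k b.
Proof.
move: a b; apply: mpoly_ring_ind => [c|i|a a' ha ha'|a a' ha ha'] b.
- by rewrite /cover msubstC !mul_mpolyC linearZ.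
- rewrite /cover msubstX.
  rewrite [b]mpolyE mulr_sumr !linear_sum mulr_sumr; apply: eq_bigr => m _ /=.
  rewrite -scalerAr !linearZ -[RHS]scalerAr; congr (_ *: _) => /=.
  case: eqP => [->|/eqP ii0].
    rewrite mpolyXn -mpolyXD !componentX mnmDE mulmnE mnm1E eqxx modnMDl.
    case: eqP => _; last by rewrite mulr0.
    rewrite -mpolyXD; congr 'X_[_]; apply/mnmP => j.
    rewrite !(mnmE, mnmDE, mulmnE, mnm1E); case: (eqVneq j i0) => [->|ji].
      by rewrite ?eqxx divnMDl. 
    by [].

  rewrite -mpolyXD !componentX mnmDE mnm1E (negbTE ii0) add0n.
  case: eqP => _; last by rewrite mulr0.
  rewrite -mpolyXD; congr 'X_[_]; apply/mnmP => j.
  rewrite !(mnmE, mnmDE, mnm1E); case: (eqVneq j i0) => [->|ji] //.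
  by rewrite (negbTE ii0).
- by rewrite rmorphD !mulrDl linearD /= ha ha'.
- by rewrite rmorphM /= -!mulrA ha ha'.
Qed.

Lemma componentXn k k' : (k' < l)%N -> component k ('X_i0 ^+ k') = (k' == k)%:R.
Proof.
move=> k'l; rewrite mpolyXn componentX mulmnE mnm1E eqxx mul1n modn_small //.
case: eqP => _ //; rewrite (_ : mdivn _ = 0%MM) ?mpolyX0 //; apply/mnmP => j.
rewrite !(mnmE, mulmnE, mnm1E); case: (eqVneq j i0) => [_|_].
  by rewrite ?eqxx mul1n divn_small.
by rewrite mul0n.
Qed.

Lemma cover_decomposition b : b = \sum_(k < l) cover (component k b) * 'X_i0 ^+ k.
Proof.
rewrite {1 2}[b]mpolyE.
under [RHS]eq_bigr => k _ do rewrite [component k _]linear_sum /= linear_sum mulr_suml.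
rewrite [RHS]exchange_big; apply: eq_bigr => m _ /=.
under eq_bigr => k _ do rewrite !linearZ /= -scalerAl.
rewrite -scaler_sumr; congr (_ *: _).
rewrite (bigD1 (Ordinal (ltn_pmod (m i0) l_gt0))) //= big1 ?addr0; last first.
  move=> k /negbTE km; rewrite componentX ifF ?raddf0 ?mul0r //.
  by rewrite eq_sym; apply: contraFF km => /eqP e; apply/eqP/val_inj.
rewrite componentX eqxx (mpolyXE_id _ m) (mpolyXE_id _ (mdivn m)) rmorph_prod.
rewrite (bigD1 i0) //= [in RHS](bigD1 i0) //=.
rewrite mulrAC; congr (_ * _).
  rewrite rmorphXn /= /cover msubstX eqxx mnmE eqxx -exprM -exprD.
  by rewrite mulnC -divn_eq.
by apply: eq_bigr => j /negbTE ji; rewrite rmorphXn /= /cover msubstX ji mnmE ji.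
Qed.

(** For c a power of z, a deck transformation of the cover. *)
Definition rotate (c : K) : S -> S := msubst (fun i => if i == i0 then c *: 'X_i else 'X_i).
HB.instance Definition _ c := GRing.LRMorphism.copy (rotate c)
  (msubst (fun i => if i == i0 then c *: 'X_i else 'X_i)).

Lemma rotateX c m : rotate c 'X_[m] = c ^+ m i0 *: 'X_[m].
Proof.
rewrite mpolyXE_id rmorph_prod (bigD1 i0) //= [in RHS](bigD1 i0) //=.
rewrite rmorphXn /= /rotate msubstX eqxx exprZn scalerAl; congr (_ * _).
by apply: eq_bigr => j /negbTE ji; rewrite rmorphXn /= msubstX ji.
Qed.

Lemma component_rotate k b : component k (rotate z b) = z ^+ k *: component k b.
Proof.
elim/mpoly_linear_ind: b => [|a f g hf hg|m]; first by rewrite !raddf0.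
  by rewrite [rotate z _]linearP /= ![component k _]linearP /= hf hg scalerDr !scalerA mulrC.
rewrite rotateX linearZ /= componentX; case: eqP => [<-|_]; last by rewrite !scaler0.
by rewrite prim_expr_mod.
Qed.

Lemma rotateM c d b : rotate c (rotate d b) = rotate (c * d) b.
Proof.
elim/mpoly_linear_ind: b => [|a f g hf hg|m]; first by rewrite !raddf0.
  by rewrite ![rotate _ (_ + _)]linearP /= hf hg.
by rewrite !rotateX linearZ /= rotateX scalerA exprMn mulrC.
Qed.

Lemma rotate1 b : rotate 1 b = b.
Proof.
elim/mpoly_linear_ind: b => [|a f g hf hg|m]; first by rewrite raddf0.
  by rewrite linearP /= hf hg.
by rewrite rotateX expr1n scale1r.
Qed.

(** The k-th component of a fixed b equals z^k times itself, hence vanishes for 0 < k < l. *)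
Lemma rotate_fixed_cover b : rotate z b = b -> b = cover (component 0 b).
Proof.
move=> zb; rewrite {1}(cover_decomposition b) (bigD1 (Ordinal l_gt0)) //=.
rewrite expr0 mulr1 big1 ?addr0 // => k k0.
have /eqP := component_rotate k b; rewrite zb -subr_eq0 -{1}[component k b]scale1r.
rewrite -scalerBl scaler_eq0 subr_eq0 eq_sym -(prim_order_dvd zl).
case/orP=> [kl|/eqP->]; last by rewrite raddf0 mul0r.
by case/negP: k0; apply/eqP/val_inj/eqP; move: kl; rewrite /dvdn modn_small.
Qed.

(* The product of the conjugates of h under the rotations of 'X_i0. *)
Lemma cover_norm h : exists h' g, h * h' = cover g /\
  forall x : 'I_n -> K, x i0 = 0 -> h.@[x] != 0 -> g.@[x] != 0.
Proof.
pose H := \prod_(i < l) rotate (z ^+ i) h.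
have HE : H = cover (component 0 H).
  apply: rotate_fixed_cover; rewrite /H rmorph_prod /=.
  under eq_bigr => i _ do rewrite rotateM -exprS.
  case: (l) l_gt0 (prim_expr_order zl) => // l' _ zl1.
  by rewrite big_ord_recr big_ord_recl /= zl1 expr0 mulrC.
exists (\prod_(i < l | i != Ordinal l_gt0) rotate (z ^+ i) h), (component 0 H).
split=> [|x x0 hx].
  by rewrite -HE /H [RHS](bigD1 (Ordinal l_gt0)) //= expr0 rotate1.
have cx g : (cover g).@[x] = g.@[x].
  rewrite /cover msubst_eval; apply: meval_eq => i.
  case: eqP => [->|_]; last by rewrite mevalXU.
  by rewrite rmorphXn /= mevalXU x0 expr0n eqn0Ngt l_gt0.
rewrite -cx -HE /H rmorph_prod /=; apply/prodf_neq0 => i _.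
rewrite /rotate msubst_eval (meval_eq (v2 := x)) // => j.
case: eqP => [->|_]; last by rewrite mevalXU.
by rewrite mevalZ mevalXU x0 mulr0.
Qed.

Section CoverIdeal.
Variables (x : 'I_n -> K) (J J' : S -> Prop).
Hypothesis (J_ideal : ideal J) (J'_ideal : ideal J').
Hypothesis x0 : x i0 = 0.
Hypothesis J_cover : forall g, J g -> J' (cover g).
Hypothesis J_component : forall k g, J' g -> J (component k g).

Lemma loc_cover g : loc J x g -> loc J' x (cover g).
Proof.
apply: loc_msubst; last by move=> f /J_cover; apply: sub_loc.
move=> i; case: eqP => [->|_]; last by rewrite mevalXU.
by rewrite rmorphXn /= mevalXU x0 expr0n eqn0Ngt l_gt0.
Qed.

(** [component] is linear over the image of [cover], so the denominator h is replaced by its norm,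
    which lies in that image and is still a unit at x because x is on the ramification locus X_i0 =
    0. *)
Lemma loc_component k g : loc J' x g -> loc J x (component k g).
Proof.
case=> h [hx hg]; have [h' [g0 [hE gx]]] := cover_norm h.
exists g0; split; first exact: gx.
rewrite -component_cover -hE; apply: J_component.
by case: J'_ideal => _ _ /(_ h' _ hg); congr J'; ring.
Qed.

(** The products of a basis downstairs with the first l powers of X_i0 form a basis upstairs. *)
Lemma cover_codim N : codim (loc J x) N -> codim (loc J' x) (N * l).
Proof.
have S' := ideal_subspace (loc_ideal x J'_ideal).
case=> e [Se De].
rewrite (_ : (N * l)%N = #|{: 'I_N * 'I_l}|); last by rewrite card_prod !card_ord.
pose E (i : 'I_N * 'I_l) := cover (e i.1) * 'X_i0 ^+ i.2.
have sumE (a : 'I_N * 'I_l -> K) :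
    \sum_i a i *: E i = \sum_(k < l) cover (\sum_i a (i, k) *: e i) * 'X_i0 ^+ k.
  transitivity (\sum_i \sum_k a (i, k) *: E (i, k)).
    by rewrite pair_bigA; apply: eq_bigr => -[].
  rewrite exchange_big.
  apply: eq_bigr => k _; rewrite linear_sum mulr_suml; apply: eq_bigr => i _.
  by rewrite linearZ /= -scalerAl.
apply: (codim_card (e := E)) => [g|a].
  have /fin_all_exists[a ga] (k : 'I_l) := Se (component k g).
  exists (fun i => a i.2 i.1); rewrite sumE {1}(cover_decomposition g) -sumrB.
  apply: (subspace_sum S') => k _; rewrite -mulrBl -raddfB.
  by rewrite mulrC; apply: idealM; [apply: loc_ideal|apply: loc_cover].
rewrite sumE => aE [i k]; apply: (De (fun i => a (i, k))).
have := loc_component k aE; rewrite [component k _]linear_sum (bigD1 k) //= [X in _ + X]big1 ?addr0.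
  by rewrite component_cover componentXn // eqxx mulr1.
move=> k' /negbTE kk'; rewrite component_cover componentXn //.
by rewrite (_ : (k' == k :> nat) = false) ?mulr0.
Qed.

(** [component 0] is a retraction of [cover] compatible with the ideals, so finiteness descends. *)
Lemma cover_codim_le M : codim_le (loc J' x) M -> codim_le (loc J x) M.
Proof.
apply: (codim_le_preim (L := cover)) => g /= /(loc_component 0).
by have := component_cover 0 g ('X_i0 ^+ 0); rewrite componentXn // expr0 !mulr1 => ->.
Qed.

End CoverIdeal.
End Cover.

(** * The singular point of the cusp *)

Section UnmixedOrd.
Variables (K : fieldType) (n : nat) (x : 'I_n.+2 -> K).
Local Notation S := {mpoly K[n.+2]}.

Lemma regular_mod_ideal_gen (f : 'I_n.+1 -> S) (g : S) M :
  codim_le (loc (adjoin (ideal_gen f) g) x) M -> regular_mod x (ideal_gen f) g.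
Proof.
pose p i := if (i < n.+1)%N then f (inord i) else g.
have pf (j : 'I_n.+1) : p j = f j by rewrite /p ltn_ord inord_val.
have pg : p n.+1 = g by rewrite /p ltnn.
have gen_f a : gen n.+1 p a <-> ideal_gen f a.
  split=> [[q ->]|[q ->]].
    by exists q; apply: eq_bigr => i _; rewrite pf.
  by exists (fun i => q (inord i)); apply: eq_bigr => i _; rewrite pf inord_val.
have gen_g a : adjoin (ideal_gen f) g a -> gen n.+2 p a.
  case=> h /gen_f [q aq]; exists (fun i => if (i < n.+1)%N then q i else h).
  rewrite big_ord_recr /= ltnn pg -[LHS](subrK (h * g)) aq; congr (_ + _).
  by apply: eq_bigr => i _; rewrite ltn_ord.
move=> cM a ga; apply: (loc_mono (fun a => (gen_f a).1)).
apply: (loc_unmixed (M := M)).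
  move=> w; have [c [c0 cw]] := cM w; exists c; split=> //.
  exact: loc_mono cw.
by rewrite pg; apply: loc_mono ga => b /gen_f.
Qed.

End UnmixedOrd.

Section CuspSingular.
Variables (K : fieldType) (n l m : nat) (z : K).
Hypothesis l_gt0 : (0 < l)%N.
Hypothesis zl : l.-primitive_root z.
Hypothesis lm_coprime : coprime l m.
Local Notation S := {mpoly K[n.+2]}.
Local Notation B := {mpoly K[n.+1]}.
Local Notation X := ('X_(penult n) : S).
Local Notation Y := ('X_ord_max : S).
Variables (f : 'I_n.+1 -> S) (u : 'I_n.+1 -> K).
Hypothesis u0 : u ord_max = 0.
Local Notation x := (cusp_point l m u).
Let i0 := penult n.
Let cov : S -> S := cover l i0.

Let i0_max : (ord_max == i0) = false.
Proof. by apply/negbTE; rewrite neq_lift. Qed.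

Let x_i0 : x i0 = 0.
Proof. by rewrite /cusp_point cusp_var_penult rmorphXn /= mevalXU u0 expr0n eqn0Ngt l_gt0. Qed.

Let J' := adjoin (ideal_gen (fun j => cov (f j))) (cov (cusp_eq K n l m)).
(* The i-th factor of y^l - X^(lm). *)
Let branch (i : nat) : S := Y - (z ^+ i *: X) ^+ m.

(** As m is prime to l, z^m is again a primitive l-th root of unity; the factorization of Y^l -
    (X^m)^l is taken with it. *)
Let cov_eq : cov (cusp_eq K n l m) = \prod_(i < l) branch i.
Proof.
rewrite /cov /cusp_eq /cover rmorphB !rmorphXn /= !msubstX -/i0 i0_max eqxx.
rewrite -exprM mulnC exprM.
have zml : l.-primitive_root (z ^+ m) by rewrite (prim_root_exp_coprime _ zl) coprime_sym.
have X0 : X ^+ m != 0.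
  rewrite mpolyXn; apply: contraTneq (oner_neq0 K) => /(congr1 (mcoeff (U_(i0) *+ m))).
  by rewrite mcoeffX eqxx mcoeff0 negbK => /eqP.
rewrite -(prod_sub_unity_root (@mpolyC n.+2 K) _ zml X0).
by apply: eq_bigr => i _; rewrite /branch exprZn mul_mpolyC -!exprM mulnC.
Qed.

Let branch_ideal i := adjoin (ideal_gen (fun j => cov (f j))) (branch i).

Let branch_param i (j : 'I_n.+1) : S := if j == ord_max then z ^+ i *: X else 'X_(lift ord_max j).
Let param_branch i (j : 'I_n.+2) : B :=
  if j == i0 then (z ^+ i)^-1 *: 'X_ord_max else cusp_var K l m j.

Let zi_neq0 i : z ^+ i != 0.
Proof.
apply: expf_neq0; apply: contraTneq (oner_neq0 K) => z0.
by rewrite -(prim_expr_order zl) z0 expr0n eqn0Ngt l_gt0 eqxx.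
Qed.

Let zil i : (z ^+ i) ^+ l = 1.
Proof. by rewrite -exprM mulnC exprM (prim_expr_order zl) expr1n. Qed.

(** The branch y = (z^i X)^m is a graph with coordinate u = z^i X. As (z^i)^l = 1, x = X^l = u^l
    there, so every branch carries the same reduced equations. *)
Let branch_codim i N :
  codim (loc (branch_ideal i) x) N <-> codim (loc (param_ideal l m f) u) N.
Proof.
have IG := ideal_ideal_gen (fun j => cov (f j)).
have IS : ideal (branch_ideal i) by apply: adjoin_ideal.
have IB : ideal (param_ideal l m f) by apply: param_ideal_ideal.
have LS := loc_ideal x IS; have LB := loc_ideal u IB.
have branch_in : loc (branch_ideal i) x (branch i) by apply: sub_loc; apply: adjoin_gen.
have h1x j : (param_branch i j).@[u] = x j.
  rewrite /param_branch; case: eqP => [->|//].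
  by rewrite x_i0 mevalZ mevalXU u0 mulr0.
have h2x j : (branch_param i j).@[x] = u j.
  rewrite /branch_param; case: eqP => [->|/eqP jm].
    by rewrite mevalZ mevalXU x_i0 mulr0 u0.
  by rewrite mevalXU /cusp_point cusp_var_lift // mevalXU.
have pc g : msubst (param_branch i) (cov g) = msubst (cusp_var K l m) g.
  apply: (mpoly_rmorph_ext (phi := msubst (param_branch i) \o cover l i0)) => [c|j] /=.
    by rewrite /cover !msubstC.
  rewrite /cover !msubstX; case: eqP => [->|/eqP ji].
    rewrite rmorphXn /= msubstX /param_branch eqxx exprZn exprVn zil invr1 scale1r.
    by rewrite cusp_var_penult.
  by rewrite msubstX /param_branch (negbTE ji).
have pb : msubst (param_branch i) (branch i) = 0.
  rewrite /branch rmorphB rmorphXn /= linearZ /= !msubstX /param_branch i0_max eqxx.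
  by rewrite scalerA mulfV // scale1r cusp_var_max subrr.
have phiJ g : branch_ideal i g -> loc (param_ideal l m f) u (msubst (param_branch i) g).
  case=> h [q gq]; apply: sub_loc; exists (fun j => msubst (param_branch i) (q j)).
  have /(congr1 (msubst (param_branch i))) := gq.
  rewrite rmorphB rmorphM /= pb mulr0 subr0 => ->; rewrite raddf_sum /=.
  by apply: eq_bigr => j _; rewrite rmorphM /= pc.
have cb j : loc (branch_ideal i) x
    (msubst (branch_param i) (cusp_var K l m j) - cov 'X_j).
  rewrite /cov /cover msubstX; elim/index_cases: j => [||j jm].
  - rewrite i0_max cusp_var_max rmorphXn /= msubstX /branch_param eqxx.
    by rewrite -opprB; apply: idealN.
  - rewrite eqxx cusp_var_penult rmorphXn /= msubstX /branch_param eqxx.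
    by rewrite exprZn zil scale1r; apply: ideal_refl.
  - rewrite ifF; last by rewrite (inj_eq lift_inj); apply/negbTE.
    by rewrite cusp_var_lift // msubstX /branch_param (negbTE jm); apply: ideal_refl.
have psiJ g : param_ideal l m f g -> loc (branch_ideal i) x (msubst (branch_param i) g).
  case=> q ->; rewrite raddf_sum /=; apply: (subspace_sum (ideal_subspace LS)) => j _.
  rewrite rmorphM /=; apply: (idealM LS); apply: (ideal_mem LS (b := cov (f j))); last first.
    apply: sub_loc; apply: adjoin_sub; exists (fun k => (k == j)%:R).
    rewrite (bigD1 j) //= eqxx mul1r big1 ?addr0 // => k /negbTE ->; exact: mul0r.
  apply: (rmorph_cong (phi := msubst (branch_param i) \o msubst (cusp_var K l m))
    (psi := cover l i0)) => //= [c|k].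
    by rewrite /cover !msubstC.
  by rewrite [msubst (cusp_var K l m) _]msubstX.
have pp j : loc (branch_ideal i) x (msubst (branch_param i) (param_branch i j) - 'X_j).
  rewrite /param_branch; case: eqP => [->|/eqP ji].
    rewrite linearZ /= msubstX /branch_param eqxx scalerA mulVf // scale1r.
    exact: ideal_refl.
  by have := cb j; rewrite /cov /cover msubstX (negbTE ji).
have pp' j : loc (param_ideal l m f) u (msubst (param_branch i) (branch_param i j) - 'X_j).
  rewrite /branch_param; case: eqP => [->|/eqP jm].
    rewrite linearZ /= msubstX /param_branch eqxx scalerA mulfV // scale1r.
    exact: ideal_refl.
  rewrite msubstX /param_branch ifF; last by rewrite (inj_eq lift_inj); apply/negbTE.
  by rewrite cusp_var_lift //; apply: ideal_refl.
split.
  exact: (codim_transfer IS IB h1x h2x phiJ psiJ pp pp').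
exact: (codim_transfer IB IS h2x h1x psiJ phiJ pp' pp).
Qed.

Let J'_ideal : ideal J'. Proof. exact/adjoin_ideal/ideal_ideal_gen. Qed.

Let param_cover N : codim (loc (param_ideal l m f) u) N -> codim (loc J' x) (l * N).
Proof.
move=> CN; rewrite /J' cov_eq.
have bN (i : 'I_l) : codim (loc (branch_ideal i) x) N by apply/branch_codim.
have := codim_prod (x := x) (index_enum 'I_l) (g := branch \o @nat_of_ord l) (M := N)
  (ideal_ideal_gen (fun j => cov (f j))).
rewrite -[size _]/(size (index_enum 'I_l)) /index_enum -enumT size_enum_ord.
apply=> // i; apply: (regular_mod_ideal_gen (M := N)).
apply: codim_codim_le (bN i); apply: ideal_subspace.
exact: (loc_ideal x (adjoin_ideal _ (ideal_ideal_gen _))).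
Qed.

(** If both dimensions are finite, l times each is the dimension on the cover. To get one finiteness
    from the other: the ideal on the cover lies in that of a branch, and conversely [cover_codim_le]
    applies. *)
Lemma singular_codim N :
  codim (loc (cusp_ideal l m f) x) N <-> codim (loc (param_ideal l m f) u) N.
Proof.
have IS := cusp_ideal_ideal l m f; have IB := param_ideal_ideal l m f.
have J_cover g : cusp_ideal l m f g -> J' (cov g).
  case=> h [q gq]; exists (cov h), (fun j => cov (q j)).
  rewrite -rmorphM -rmorphB gq raddf_sum /=.
  by apply: eq_bigr => j _; rewrite rmorphM.
have cm k a b : component l i0 k (a * cov b) = component l i0 k a * b.
  by rewrite [a * _]mulrC component_cover // mulrC.
have J_comp k g : J' g -> cusp_ideal l m f (component l i0 k g).
  case=> h [q gq]; exists (component l i0 k h), (fun j => component l i0 k (q j)).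
  have := congr1 (component l i0 k) gq.
  rewrite [component _ _ _ _]linearB /= [component _ _ _ (\sum_i _)]linear_sum /=.
  by rewrite cm => ->; apply: eq_bigr => j _; rewrite cm.
have SJ' := ideal_subspace (loc_ideal x J'_ideal).
have key N' M : codim (loc (cusp_ideal l m f) x) N' ->
    codim (loc (param_ideal l m f) u) M -> N' = M.
  move=> CN /param_cover CM.
  have CN' := cover_codim l_gt0 zl J'_ideal x_i0 J_cover J_comp CN.
  have /eqP := codim_unique SJ' CN' CM.
  by rewrite mulnC eqn_pmul2l // => /eqP.
split=> [CN|CN].
  have CN' := cover_codim l_gt0 zl J'_ideal x_i0 J_cover J_comp CN.
  have [M CM] : exists M, codim (loc (branch_ideal 0%N) x) M.
    apply: (@codim_le_codim _ _ _ _ (N * l)%N).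
      exact: ideal_subspace (loc_ideal x (adjoin_ideal _ (ideal_ideal_gen _))).
    move=> w; have [a [a0 aw]] := codim_codim_le SJ' CN' w; exists a; split=> //.
    apply: loc_mono aw => g [h hg]; exists (h * \prod_(i < l | i != Ordinal l_gt0) branch i).
    move: hg; rewrite cov_eq (bigD1 (Ordinal l_gt0)) //=; congr ideal_gen; ring.
  have {}CM : codim (loc (param_ideal l m f) u) M by apply/(branch_codim 0%N M).
  by rewrite (key _ _ CN CM).
have [M CM] : exists M, codim (loc (cusp_ideal l m f) x) M.
  apply: (@codim_le_codim _ _ _ _ (l * N)%N); first exact: ideal_subspace (loc_ideal x IS).
  apply: (cover_codim_le l_gt0 zl J'_ideal x_i0 J_comp).
  exact (codim_codim_le SJ' (param_cover CN)).
by rewrite -(key _ _ CM CN).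
Qed.

End CuspSingular.

(** * Multiplicity as a codimension *)

Section Multiplicity.
Variables (K : fieldType) (n : nat) (J : {mpoly K[n]} -> Prop) (x : {ffun 'I_n -> K}).
Hypothesis J_ideal : ideal J.
Local Notation S := {mpoly K[n]}.
Local Notation F := {fraction {mpoly K[n]}}.
Local Notation tf := (@tofrac S).
Local Notation JO := (in_local_ideal x J).
Local Notation L := (loc J x).

Let LI : ideal L := loc_ideal x J_ideal.
Let LS : subspace L := ideal_subspace LI.

Lemma neq0_of_eval (g : S) : g.@[x] != 0 -> g != 0.
Proof. by apply: contraNneq => ->; rewrite meval0. Qed.

Lemma in_local_ideal_tofrac g : JO (tf g) <-> L g.
Proof.
split=> [[j [v [Jj vx gE]]]|[v [vx Jvg]]].
  have v0 : tf v != 0 by rewrite tofrac_eq0 neq0_of_eval.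
  exists v; split=> //; suff -> : v * g = j by [].
  by apply/eqP; rewrite -tofrac_eq tofracM gE mulrC divfK.
exists (v * g), v; split=> //.
by rewrite tofracM mulrC mulKf // tofrac_eq0 neq0_of_eval.
Qed.

Lemma in_local_idealD a b : JO a -> JO b -> JO (a + b).
Proof.
case: J_ideal => _ JD JM [j [v [Jj vx ->]]] [j' [v' [Jj' vx' ->]]].
have [v0 v0'] : tf v != 0 /\ tf v' != 0 by rewrite !tofrac_eq0 !neq0_of_eval.
exists (j * v' + j' * v), (v * v'); split.
- by apply: JD; rewrite mulrC; apply: JM.
- by rewrite mevalM mulf_neq0.
have E := addf_div (tf j) (tf j') v0 v0'.
by rewrite E -tofracM -tofracM -tofracM -tofracD.
Qed.

Lemma in_local_idealM z a : in_local_ring x z -> JO a -> JO (z * a).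
Proof.
case: J_ideal => _ _ JM [f [g [gx ->]]] [j [v [Jj vx ->]]].
exists (f * j), (g * v); split; first exact: JM.
- by rewrite mevalM mulf_neq0.
by rewrite mulf_div -!tofracM.
Qed.

Lemma in_local_ring_tofrac f : in_local_ring x (tf f).
Proof. by exists f, 1; rewrite meval1 oner_neq0 tofrac1 divr1. Qed.

Lemma in_local_idealZ f a : JO a -> JO (tf f * a).
Proof. by apply: in_local_idealM; apply: in_local_ring_tofrac. Qed.

Lemma in_local_idealN a : JO a -> JO (- a).
Proof. by move/(in_local_idealZ (-1)); rewrite tofracN tofrac1 mulN1r. Qed.

Lemma in_local_ideal_sum (I : finType) (G : I -> F) :
  (forall i, JO (G i)) -> JO (\sum_i G i).
Proof.
move=> JG; elim/big_ind: _ => //; last exact: in_local_idealD.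
by rewrite -tofrac0; apply/in_local_ideal_tofrac; exact: subspace0.
Qed.

Lemma tofrac_sum N (a : 'I_N -> K) (e : 'I_N -> S) :
  \sum_i tf (a i)%:MP * tf (e i) = tf (\sum_i a i *: e i).
Proof.
rewrite [RHS]raddf_sum; apply: eq_bigr => i _.
by rewrite -mul_mpolyC /= tofracM.
Qed.

Lemma local_poly M z : codim_le L M -> in_local_ring x z -> exists f, JO (z - tf f).
Proof.
move=> LM [f [g [gx ->]]]; have [t Lt] := loc_inverse J_ideal LM gx.
have g0 : tf g != 0 by rewrite tofrac_eq0 neq0_of_eval.
exists (f * t).
have -> : tf f / tf g - tf (f * t) = (tf f / tf g) * tf (1 - g * t).
  by rewrite tofracB tofrac1 !tofracM mulrBr mulr1 mulrA divfK.
apply: in_local_idealM; first by exists f, g.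
exact/in_local_ideal_tofrac.
Qed.

(** In finite dimension every denominator has a polynomial inverse modulo L, so each class has a
    polynomial representative. *)
Lemma has_multP N : has_mult J x N <-> codim L N.
Proof.
split=> [[e [Oe eP]]|CN].
  (* Coordinates chosen separately for each z, as [codim_le_coord] permits. *)
  pose c z := match excluded_middle_informative (in_local_ring x z) with
    | left Oz => proj1_sig (constructive_indefinite_description _ (eP z Oz))
    | right _ => [ffun=> 0] end.
  have cP z : in_local_ring x z -> JO (z - \sum_i tf (c z i)%:MP * e i).
    move=> Oz; rewrite /c; case: excluded_middle_informative => // Oz'.
    by case: constructive_indefinite_description => a [].
  have LM : codim_le L N.
    apply: (@codim_le_coord _ _ L N (fun f j => c (tf f) j)) => a z az.
    apply/in_local_ideal_tofrac.
    have -> : tf (\sum_i a i *: z i) =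
        \sum_i tf (a i)%:MP * (tf (z i) - \sum_j tf (c (tf (z i)) j)%:MP * e j).
      under [RHS]eq_bigr => i _ do rewrite mulrBr.
      rewrite sumrB tofrac_sum [X in _ = _ - X](_ : _ = 0) ?subr0 //.
      under eq_bigr => i _ do rewrite mulr_sumr.
      rewrite exchange_big big1 //= => j _.
      under eq_bigr => i _ do rewrite mulrA -tofracM -mpolyCM.
      rewrite -mulr_suml -raddf_sum -raddf_sum az /= mpolyC0 tofrac0 mul0r //.
    apply: in_local_ideal_sum => i; apply: in_local_idealZ; apply: cP.
    exact: in_local_ring_tofrac.
  have /fin_all_exists[e' ee'] i := local_poly LM (Oe i).
  have diff (a : 'I_N -> K) :
      JO (\sum_i tf (a i)%:MP * e i - tf (\sum_i a i *: e' i)).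
    rewrite -tofrac_sum -sumrB; apply: in_local_ideal_sum => i.
    by rewrite -mulrBr; apply: in_local_idealZ.
  exists e'; split=> [f|a La].
    exists (c (tf f)); apply/in_local_ideal_tofrac.
    have := in_local_idealD (cP _ (in_local_ring_tofrac f)) (diff (c (tf f))).
    by rewrite addrA subrK tofracB.
  (* Two expansions of 0, with coordinates a and 0; uniqueness identifies them. *)
  have a0 : JO (0 - \sum_i tf ([ffun i => a i] i)%:MP * e i).
    under eq_bigr => i _ do rewrite ffunE.
    move/in_local_ideal_tofrac: La => /(in_local_idealD (diff a)); rewrite subrK sub0r.
    exact: in_local_idealN.
  have z0 : JO (0 - \sum_i tf ([ffun=> 0] i : K)%:MP * e i).
    rewrite big1 => [|i _]; last by rewrite ffunE mpolyC0 tofrac0 mul0r.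
    by rewrite subrr -tofrac0; apply/in_local_ideal_tofrac; exact: subspace0.
  have O0 : in_local_ring x 0 by rewrite -tofrac0; apply: in_local_ring_tofrac.
  have [b [_ bu]] := eP 0 O0; move=> i.
  have := congr1 (fun h : {ffun 'I_N -> K} => h i) (etrans (esym (bu _ a0)) (bu _ z0)).
  by rewrite !ffunE.
have LM := codim_codim_le LS CN; case: CN => e [Se De].
exists (fun i => tf (e i)); split=> [i|z Oz]; first exact: in_local_ring_tofrac.
have [f fz] := local_poly LM Oz; have [a fa] := Se f.
exists [ffun i => a i]; split=> [|b zb].
  rewrite tofrac_sum; under eq_bigr => i _ do rewrite ffunE.
  move/in_local_ideal_tofrac: fa => /(in_local_idealD fz).
  by rewrite tofracB addrA subrK.
apply/ffunP => i; rewrite ffunE; apply/eqP; rewrite -subr_eq0; apply/eqP.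
apply: (De (fun i => a i - b i)).
have -> : \sum_i (a i - b i) *: e i = (f - \sum_i b i *: e i) - (f - \sum_i a i *: e i).
  under eq_bigr => j _ do rewrite scalerBl.
  rewrite sumrB; move: (\sum_i _) (\sum_i _) => A B; ring.
apply: (subspaceB LS) => //; apply/in_local_ideal_tofrac.
move: zb; rewrite tofrac_sum => /(in_local_idealD (in_local_idealN fz)).
by rewrite opprB addrA subrK tofracB.
Qed.

End Multiplicity.

(** * Parametrization of the torus translates of the cusp *)

(** X^l - 1 is separable in characteristic zero, which gives l distinct l-th roots of unity; they
    form a cyclic group. *)
Lemma exists_primitive_root (K : closedFieldType) l :
  (0 < l)%N -> [pchar K] =i pred0 -> exists z : K, l.-primitive_root z.
Proof.
move=> l0 K0; pose p : {poly K} := 'X^l - 1.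
have [r Dp] := closed_field_poly_normal p.
have pm : p \is monic by apply: monicXnsubC.
rewrite (monicP pm) scale1r in Dp.
have rn1 : all l.-unity_root r.
  by apply/allP => z; rewrite -root_prod_XsubC -Dp.
have sz_r : (l < (size r).+1)%N.
  by rewrite -(size_prod_XsubC r id) -Dp size_XnsubC.
have [|z] := hasP (has_prim_root l0 rn1 _ sz_r); last by exists z.
rewrite -separable_prod_XsubC -Dp separable_Xn_sub_1 //.
by rewrite (proj1 (pcharf0P K) K0) -lt0n.
Qed.

Section CuspCodim.
Variables (K : closedFieldType) (n l m a b : nat).
Hypothesis K_char0 : [pchar K] =i pred0.
Hypothesis (l_gt0 : (0 < l)%N) (m_gt0 : (0 < m)%N).
Hypothesis ab : (a * l = b * m + 1)%N.
Local Notation S := {mpoly K[n.+2]}.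

Lemma cusp_coprime : coprime l m.
Proof.
by apply/coprimeP => //; exists (a, b); rewrite /= ab addKn.
Qed.

Lemma cusp_codim (f : 'I_n.+1 -> S) (u : 'I_n.+1 -> K) N :
  codim (loc (cusp_ideal l m f) (cusp_point l m u)) N <->
  codim (loc (param_ideal l m f) u) N.
Proof.
case: (eqVneq (u ord_max) 0) => u0; last exact: smooth_codim ab _.
have [z zl] := exists_primitive_root l_gt0 K_char0.
exact: (singular_codim l_gt0 zl cusp_coprime).
Qed.

Lemma cusp_point_surj (x : 'I_n.+2 -> K) :
  x ord_max ^+ l = x (penult n) ^+ m -> exists u, x =1 cusp_point l m u.
Proof.
move=> xyE; pose X := x (penult n); pose Y := x ord_max.
exists (fun j => if j == ord_max then X ^+ a / Y ^+ b else x (lift ord_max j)).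
have pow0 k : (0 < k)%N -> (0 : K) ^+ k = 0 by move=> k0; rewrite expr0n eqn0Ngt k0.
(* Since a > 0, the witness X^a / Y^b is 0 when X = Y = 0. *)
have a_gt0 : (0 < a)%N by case: (a) ab; rewrite ?mul0n ?addn1.
case: (eqVneq X 0) => X0.
  have Y0 : Y = 0.
    by apply/eqP; move/eqP: xyE; rewrite -/X -/Y X0 pow0 // expf_eq0 l_gt0.
  elim/index_cases => [||j jm]; rewrite /cusp_point.
  - by rewrite cusp_var_max rmorphXn /= mevalXU eqxx X0 pow0 // mul0r pow0.
  - by rewrite cusp_var_penult rmorphXn /= mevalXU eqxx X0 pow0 // mul0r pow0.
  - by rewrite cusp_var_lift // mevalXU (negbTE jm).
have Y0 : Y != 0.
  apply: contraNneq X0 => Y0; move/eqP: xyE; rewrite -/X -/Y Y0 pow0 // eq_sym.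
  by rewrite expf_eq0 m_gt0.
elim/index_cases => [||j jm]; rewrite /cusp_point.
- rewrite cusp_var_max rmorphXn /= mevalXU eqxx expr_div_n -!exprM.
  rewrite [(a * m)%N]mulnC exprM -xyE -exprM mulnC ab addn1 exprS.
  by rewrite mulfK // expf_neq0.
- rewrite cusp_var_penult rmorphXn /= mevalXU eqxx expr_div_n -!exprM.
  rewrite ab addn1 [(b * l)%N]mulnC exprM -/Y xyE -exprM mulnC exprS.
  by rewrite mulfK // expf_neq0.
- by rewrite cusp_var_lift // mevalXU (negbTE jm).
Qed.

Lemma cusp_point_inj (u v : 'I_n.+1 -> K) : cusp_point l m u =1 cusp_point l m v -> u =1 v.
Proof.
move=> uv j; case: (eqVneq j ord_max) => [->|jm]; last first.
  by have := uv (lift ord_max j); rewrite /cusp_point cusp_var_lift // !mevalXU.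
have := uv ord_max; have := uv (penult n).
rewrite /cusp_point cusp_var_max cusp_var_penult !rmorphXn /= !mevalXU => ul um.
case: (eqVneq (u ord_max) 0) => [u0|u0].
  apply/eqP; move/eqP: ul; rewrite u0 expr0n eqn0Ngt l_gt0 eq_sym expf_eq0 l_gt0 /=.
  by rewrite eq_sym.
have v0 : v ord_max != 0.
  apply: contraNneq u0 => v0; move/eqP: ul.
  by rewrite v0 expr0n eqn0Ngt l_gt0 expf_eq0 l_gt0.
have E w : w != 0 -> w = (w ^+ l) ^+ a / (w ^+ m) ^+ b :> K.
  move=> w0; rewrite -!exprM [(l * a)%N]mulnC ab [(m * b)%N]mulnC addn1 exprS.
  by rewrite mulfK // expf_neq0.
by rewrite (E _ u0) (E _ v0) ul um.
Qed.

Variables (alpha beta : 'I_n.+2 -> 'X_{1..n.+2}) (c t : 'I_n.+2 -> K).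
Hypothesis alpha_last : alpha ord_max = (U_(ord_max) *+ l)%MM.
Hypothesis beta_last : beta ord_max = (U_(penult n) *+ m)%MM.
Hypothesis t_neq0 : forall i, t i != 0.
Let mono (e : 'X_{1..n.+2}) := mmap1 t e.
Hypothesis c_last : c ord_max * mono (beta ord_max) = mono (alpha ord_max).

Let binom (c : 'I_n.+2 -> K) j : S := binomial_poly (alpha j) (beta j) (c j).
(** The parameters after x_i -> t_i x_i, with the first coefficient normalized to 1; by [c_last] the
    last parameter becomes 1. *)
Let c' j := c j * mono (beta j) / mono (alpha j).

Definition reduced_binomial (j : 'I_n.+1) : {mpoly K[n.+1]} :=
  msubst (cusp_var K l m) (binom c' (lift ord_max j)).

Definition torus_cusp_point (u : {ffun 'I_n.+1 -> K}) : {ffun 'I_n.+2 -> K} :=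
  [ffun i => t i * cusp_point l m u i].

Let mono_neq0 e : mono e != 0.
Proof. by apply/prodf_neq0 => i _; apply: expf_neq0. Qed.

Let scaleX (s : 'I_n.+2 -> K) e :
  msubst (fun i => s i *: 'X_i : S) 'X_[e] = mmap1 s e *: 'X_[e].
Proof.
rewrite mpolyXE_id rmorph_prod /= /mmap1 -scaler_prod; apply: eq_bigr => i _.
by rewrite rmorphXn /= msubstX exprZn.
Qed.

Let scale_binom j :
  msubst (fun i => t i *: 'X_i : S) (binom c j) = mono (alpha j) *: binom c' j.
Proof.
rewrite /binom /binomial_poly rmorphB /= linearZ /= !scaleX scalerBr !scalerA.
by rewrite /c' [_ * (_ / _)]mulrC divfK.
Qed.

Let binom_last : binom c' ord_max = cusp_eq K n l m.
Proof.
rewrite /binom /binomial_poly /c' c_last divff // scale1r alpha_last beta_last.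
by rewrite /cusp_eq !mpolyXn.
Qed.

Lemma binom_eval j x : (binom c j).@[fun i => t i * x i] = mono (alpha j) * (binom c' j).@[x].
Proof.
rewrite -mevalZ -scale_binom msubst_eval; apply: meval_eq => i.
by rewrite mevalZ mevalXU.
Qed.

Lemma reduced_binomial_eval j u :
  (reduced_binomial j).@[u] = (binom c' (lift ord_max j)).@[cusp_point l m u].
Proof. exact: msubst_eval. Qed.

Lemma torus_cusp_point_inj : injective torus_cusp_point.
Proof.
move=> u v uv; apply/ffunP; apply: cusp_point_inj => i.
by have /ffunP/(_ i) := uv; rewrite !ffunE => /(mulfI (t_neq0 i)).
Qed.

Lemma torus_cusp_zeros (x : {ffun 'I_n.+2 -> K}) :
  (forall j, (binom c j).@[x] = 0) <->
  exists2 u : {ffun 'I_n.+1 -> K}, forall j, (reduced_binomial j).@[u] = 0 & x = torus_cusp_point u.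
Proof.
split=> [x0|[u u0 ->] j].
  pose y i := x i / t i.
  have xy : x =1 (fun i => t i * y i) by move=> i; rewrite mulrC divfK.
  have y0 j : (binom c' j).@[y] = 0.
    apply/eqP; have := x0 j; rewrite (meval_eq _ xy) binom_eval => /eqP.
    by rewrite mulf_eq0 (negbTE (mono_neq0 _)).
  have [|u yu] := cusp_point_surj (x := y).
    apply/eqP; rewrite -subr_eq0; have := y0 ord_max.
    by rewrite binom_last /cusp_eq mevalB !rmorphXn /= !mevalXU => ->.
  exists [ffun j => u j] => [j|].
    rewrite reduced_binomial_eval -(y0 (lift ord_max j)); apply: meval_eq => i.
    by rewrite yu /cusp_point; apply: meval_eq => k; rewrite ffunE.
  apply/ffunP => i; rewrite ffunE xy yu; congr (_ * _).
  by rewrite /cusp_point; apply: meval_eq => k; rewrite ffunE.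
rewrite (meval_eq (v2 := fun i => t i * cusp_point l m u i)) => [|i]; last by rewrite ffunE.
rewrite binom_eval; case: (unliftP ord_max j) => [k|] ->.
  by rewrite -reduced_binomial_eval u0 mulr0.
by rewrite binom_last -msubst_eval cusp_eq_subst meval0 mulr0.
Qed.

Lemma torus_cusp_mult (u : {ffun 'I_n.+1 -> K}) N :
  has_mult (ideal_gen (binom c)) (torus_cusp_point u) N <->
  has_mult (ideal_gen reduced_binomial) u N.
Proof.
rewrite !has_multP; [|exact: ideal_ideal_gen..].
pose f j := binom c' (lift ord_max j).
rewrite -[codim (loc (ideal_gen reduced_binomial) u) N]/(codim (loc (param_ideal l m f) u) N).
rewrite -cusp_codim.
have I1 := ideal_ideal_gen (binom c); have I2 := cusp_ideal_ideal l m f.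
pose x1 : {ffun _ -> _} := torus_cusp_point u; pose x2 := cusp_point l m u.
have h1x i : (t i *: 'X_i : S).@[x2] = x1 i by rewrite mevalZ mevalXU ffunE.
have h2x i : ((t i)^-1 *: 'X_i : S).@[x1] = x2 i.
  by rewrite mevalZ mevalXU ffunE mulKf.
have binom_in j : cusp_ideal l m f (binom c' j).
  case: (unliftP ord_max j) => [k|] ->; first exact: cusp_ideal_gen.
  by rewrite binom_last; apply: adjoin_gen; apply: ideal_ideal_gen.
have gen_in j : ideal_gen (binom c) (binom c j).
  exists (fun k => (k == j)%:R).
  rewrite (bigD1 j) //= eqxx mul1r big1 ?addr0 // => k /negbTE ->; exact: mul0r.
have inv_binom j : msubst (fun i => (t i)^-1 *: 'X_i : S) (binom c' j) =
    (mono (alpha j))^-1 *: binom c j.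
  apply: (scalerI (mono_neq0 (alpha j))); rewrite scalerA mulfV // scale1r.
  rewrite -linearZ -scale_binom /=.
  apply: (mpoly_rmorph_ext (phi := msubst (fun i => (t i)^-1 *: 'X_i : S) \o
    msubst (fun i => t i *: 'X_i : S)) (psi := idfun)) => [d|i] /=.
    by rewrite !msubstC.
  by rewrite [msubst _ 'X_i]msubstX linearZ /= msubstX scalerA mulfV // scale1r.
have phiJ g : ideal_gen (binom c) g ->
    loc (cusp_ideal l m f) x2 (msubst (fun i => t i *: 'X_i : S) g).
  case=> q ->; apply: sub_loc; rewrite raddf_sum /=.
  apply: (subspace_sum (ideal_subspace I2)) => j _; rewrite rmorphM /= scale_binom.
  by apply: (idealM I2); apply: (subspaceZ (ideal_subspace I2)).
have psiJ g : cusp_ideal l m f g ->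
    loc (ideal_gen (binom c)) x1 (msubst (fun i => (t i)^-1 *: 'X_i : S) g).
  case=> h [q gE]; apply: sub_loc; rewrite -[g](subrK (h * cusp_eq K n l m)) gE.
  rewrite -binom_last rmorphD rmorphM /= raddf_sum /=.
  apply: (idealD I1); last first.
    rewrite inv_binom; apply: (idealM I1).
    exact: (subspaceZ (ideal_subspace I1)).
  apply: (subspace_sum (ideal_subspace I1)) => j _; rewrite rmorphM /= inv_binom.
  by apply: (idealM I1); apply: (subspaceZ (ideal_subspace I1)).
have pp i : loc (ideal_gen (binom c)) x1
    (msubst (fun i => (t i)^-1 *: 'X_i : S) (t i *: 'X_i) - 'X_i).
  rewrite linearZ /= msubstX scalerA mulfV // scale1r.
  by apply: ideal_refl; apply: loc_ideal.
have pp' i : loc (cusp_ideal l m f) x2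
    (msubst (fun i => t i *: 'X_i : S) ((t i)^-1 *: 'X_i) - 'X_i).
  rewrite linearZ /= msubstX scalerA mulVf // scale1r.
  by apply: ideal_refl; apply: loc_ideal.
split.
  exact: (codim_transfer I1 I2 h1x h2x phiJ psiJ pp pp').
exact: (codim_transfer I2 I1 h2x h1x psiJ phiJ pp' pp).
Qed.

(** The last two coordinates are nonzero multiples of positive powers of the same [u ord_max], so
    they vanish together. *)
Lemma torus_cusp_stratum (L : {set 'I_n.+2}) (u : {ffun 'I_n.+1 -> K}) :
  stratum L (torus_cusp_point u) <->
  (ord_max \in L) = (penult n \in L) /\ stratum (restrict_set L) u.
Proof.
have zero i : (torus_cusp_point u i == 0) = (cusp_point l m u i == 0).
  by rewrite ffunE mulf_eq0 (negbTE (t_neq0 i)).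
have zmax : (torus_cusp_point u ord_max == 0) = (u ord_max == 0).
  by rewrite zero /cusp_point cusp_var_max rmorphXn /= mevalXU expf_eq0 m_gt0.
have zpen : (torus_cusp_point u (penult n) == 0) = (u ord_max == 0).
  by rewrite zero /cusp_point cusp_var_penult rmorphXn /= mevalXU expf_eq0 l_gt0.
have zlift j : (torus_cusp_point u (lift ord_max j) == 0) = (u j == 0).
  case: (eqVneq j ord_max) => [->|jm]; first exact: zpen.
  by rewrite zero /cusp_point cusp_var_lift // mevalXU.
have stratumP k (M : {set 'I_k}) (v : {ffun 'I_k -> K}) :
    stratum M v <-> forall i, (v i == 0) = (i \in M).
  split=> vM i; last by split=> [/eqP|iM]; [rewrite vM|apply/eqP; rewrite vM].
  by apply/eqP/idP; case: (vM i).
rewrite !stratumP; split=> [xL|[maxL uL]].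
  split; first by rewrite -!xL zmax zpen.
  by move=> j; rewrite inE -xL zlift.
move=> i; case: (unliftP ord_max i) => [j|] ->; first by rewrite zlift uL inE.
by rewrite zmax uL maxL inE.
Qed.

End CuspCodim.

(** * Genericity *)

Section Generic.
Variable k : fieldType.
Hypothesis k_char0 : [pchar k] =i pred0.

Lemma poly_nonvanishing (p : {poly k}) : p != 0 -> exists s, p.[s] != 0.
Proof.
move=> p0; pose rs : seq k := [seq i%:R | i <- iota 0 (size p)].
have urs : uniq rs.
  rewrite map_inj_uniq ?iota_uniq // => i j /eqP.
  wlog: i j / (i <= j)%N => [H|ij].
    by case/orP: (leq_total i j) => /H // E; rewrite eq_sym => /E.
  rewrite eq_sym -subr_eq0 -natrB // (proj1 (pcharf0P k) k_char0) subn_eq0 => ji.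
  by apply/eqP; rewrite eqn_leq ij.
case: (boolP (all (root p) rs)) => [/(max_poly_roots p0)/(_ urs)|].
  by rewrite size_map size_iota ltnn.
by case/allPn => s _ ps; exists s.
Qed.

(** Induction on n: g is read as a polynomial M g in the last variable, and the other variables are
    given values at which its leading coefficient is nonzero. *)
Lemma mpoly_nonvanishing n (g : {mpoly k[n]}) : g != 0 -> exists c, g.@[c] != 0.
Proof.
elim: n g => [|n IH] g g0.
  exists (fun=> 0); rewrite (nvar0_mpolyC g) mevalC; apply: contra g0 => /eqP g0.
  by rewrite (nvar0_mpolyC g) g0.
pose h (i : 'I_n.+1) : {poly {mpoly k[n]}} :=
  if unlift ord_max i is Some j then ('X_j)%:P else 'X.
pose M : {mpoly k[n.+1]} -> {poly {mpoly k[n]}} := mmap (polyC \o @mpolyC n k) h.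
pose w : {mpoly k[n]} -> {mpoly k[n.+1]} := msubst (fun j => 'X_(lift ord_max j)).
have hlift j : h (lift ord_max j) = ('X_j)%:P by rewrite /h liftK.
have hmax : h ord_max = 'X by rewrite /h unlift_none.
have MC c : M c%:MP = (c%:MP)%:P by rewrite /M mmapC.
have MX i : M 'X_i = h i by rewrite /M mmapX mmap1U.
have MD p q : M (p + q) = M p + M q by rewrite /M raddfD.
have MM p q : M (p * q) = M p * M q by rewrite /M rmorphM.
have MK p : (map_poly w (M p)).['X_ord_max] = p.
  move: p; apply: mpoly_ring_ind => [c|i|p q hp hq|p q hp hq].
  - by rewrite MC /w map_polyC hornerC /= msubstC.
  - rewrite MX; case: (unliftP ord_max i) => [j|] ->.
      by rewrite hlift /w map_polyC hornerC /= msubstX.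
    by rewrite hmax /w map_polyX hornerX.
  - by rewrite MD /w rmorphD hornerD /= [X in X + _]hp [X in _ + X]hq.
  - by rewrite MM /w rmorphM hornerM /= [X in X * _]hp [X in _ * X]hq.
have Mg0 : M g != 0.
  by apply: contraNneq g0 => Mg; rewrite -(MK g) Mg /w raddf0 horner0.
have [c' c'0] : exists c', (lead_coef (M g)).@[c'] != 0 by apply: IH; rewrite lead_coef_eq0.
have [|s s0] := @poly_nonvanishing (map_poly (meval c') (M g)).
  apply: contraNneq c'0 => /(congr1 (fun q : {poly k} => q`_(size (M g)).-1)).
  by rewrite coef_map coef0 => ->.
exists (fun i => if unlift ord_max i is Some j then c' j else s).
apply: contraNneq s0 => <-; apply/eqP.
have evD p q : map_poly (meval c') (p + q) = map_poly (meval c') p + map_poly (meval c') q.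
  exact: rmorphD.
have evM p q : map_poly (meval c') (p * q) = map_poly (meval c') p * map_poly (meval c') q.
  exact: rmorphM.
move: g {g0 Mg0 c'0}; apply: mpoly_ring_ind => [c|i|p q hp hq|p q hp hq].
- by rewrite MC map_polyC hornerC /= !mevalC.
- rewrite MX mevalXU; case: (unliftP ord_max i) => [j|] ->.
    by rewrite hlift map_polyC hornerC /= mevalXU.
  by rewrite hmax map_polyX hornerX.
- by rewrite MD evD hornerD mevalD [X in X + _]hp [X in _ + X]hq.
- by rewrite MM evM hornerM mevalM [X in X * _]hp [X in _ * X]hq.
Qed.

Lemma mpoly_nonvanishing_torus n (g : {mpoly k[n]}) : g != 0 ->
  exists c, (forall j, c j != 0) /\ g.@[c] != 0.
Proof.
move=> g0; have [|c] := @mpoly_nonvanishing n (g * \prod_i 'X_i).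
  rewrite mulf_neq0 //; apply/prodf_neq0 => i _.
  apply: contraTneq (oner_neq0 k) => /(congr1 (mcoeff U_(i))).
  by rewrite mcoeffX eqxx mcoeff0 negbK => /eqP.
rewrite mevalM mulf_eq0 negb_or rmorph_prod => /andP[gc /prodf_neq0 c0].
by exists c; split=> // j; have := c0 j isT; rewrite /= mevalXU.
Qed.

Lemma clear_denominators n r (u v : 'I_n -> {mpoly k[r]}) (g : {mpoly k[n]}) :
  exists (G : {mpoly k[r]}) N, forall c, (forall j, (v j).@[c] != 0) ->
    G.@[c] = (\prod_j (v j).@[c]) ^+ N * g.@[fun j => (u j).@[c] / (v j).@[c]].
Proof.
pose D := \prod_j v j.
have DE c : D.@[c] = \prod_j (v j).@[c] by rewrite /D rmorph_prod.
move: g; apply: mpoly_ring_ind => [a|i|p q [Gp [Np hp]] [Gq [Nq hq]]|p q [Gp [Np hp]] [Gq [Nq hq]]].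
- by exists a%:MP, 0%N => c _; rewrite !mevalC mul1r.
- exists (u i * \prod_(j | j != i) v j), 1%N => c v0.
  rewrite mevalM rmorph_prod mevalXU expr1 [in RHS](bigD1 i) //=.
  by rewrite [RHS]mulrCA [X in _ = _ * X]mulrAC divff ?v0 // mul1r.
- exists (D ^+ Nq * Gp + D ^+ Np * Gq), (Np + Nq)%N => c v0.
  rewrite !mevalD !mevalM !rmorphXn /= DE hp // hq // exprD; ring.
- exists (Gp * Gq), (Np + Nq)%N => c v0.
  rewrite !mevalM hp // hq // exprD; ring.
Qed.

Section Rescale.
Variables (n : nat) (E F : 'I_n.+1 -> nat).

Definition rescale (c : 'I_n.+2 -> k) (j : 'I_n.+1) : k :=
  c (lift ord_max j) * c ord_max ^+ E j / c ord_max ^+ F j.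

Lemma rescale_neq0 c : (forall j, c j != 0) -> forall j, rescale c j != 0.
Proof. by move=> c0 j; rewrite !mulf_neq0 ?invr_neq0 ?expf_neq0. Qed.

(** For each nonzero s, [rescale] has a section [back] with last coordinate s. One direction
    restricts g to a slice where it is not identically zero; the other pulls g back along [rescale]
    and clears denominators. *)
Lemma generic_rescale (P : ('I_n.+2 -> k) -> Prop) (Q : ('I_n.+1 -> k) -> Prop) :
  (forall c, (forall j, c j != 0) -> (P c <-> Q (rescale c))) -> generic P <-> generic Q.
Proof.
move=> PQ; split=> [[g g0 gP]|[g g0 gQ]].
  have [c0 [c0n gc0]] := mpoly_nonvanishing_torus g0; pose s := c0 ord_max.
  have s0 : s != 0 by exact: c0n.
  pose h (i : 'I_n.+2) : {mpoly k[n.+1]} :=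
    if unlift ord_max i is Some j then (s ^+ F j / s ^+ E j) *: 'X_j else s%:MP.
  pose back (c' : 'I_n.+1 -> k) (i : 'I_n.+2) :=
    if unlift ord_max i is Some j then s ^+ F j / s ^+ E j * c' j else s.
  have gE c' : (msubst h g).@[c'] = g.@[back c'].
    rewrite msubst_eval; apply: meval_eq => i; rewrite /h /back.
    by case: (unlift _ _) => [j|]; rewrite ?mevalZ ?mevalXU ?mevalC.
  exists (msubst h g).
    apply: contraNneq gc0 => g0'; have := gE (rescale c0); rewrite g0' meval0 => ->.
    apply/eqP; apply: meval_eq => i; rewrite /back /rescale.
    case: (unliftP ord_max i) => [j|] -> //.
    by rewrite -/s; field; rewrite !expf_neq0.
  move=> c' c'0; rewrite gE => gc'.
  have b0 i : back c' i != 0.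
    by rewrite /back; case: (unlift _ _) => [j|] //; rewrite !mulf_neq0 ?invr_neq0 ?expf_neq0.
  have := gP _ b0 gc'; rewrite (PQ _ b0); congr Q.
  apply: functional_extensionality => j; rewrite /rescale /back liftK unlift_none.
  by field; rewrite !expf_neq0.
pose u (j : 'I_n.+1) : {mpoly k[n.+2]} := 'X_(lift ord_max j) * 'X_ord_max ^+ E j.
pose v (j : 'I_n.+1) : {mpoly k[n.+2]} := 'X_ord_max ^+ F j.
have [G [N GE]] := clear_denominators u v g.
have vE c j : (v j).@[c] = c ord_max ^+ F j by rewrite rmorphXn /= mevalXU.
have uvE c : (fun j => (u j).@[c] / (v j).@[c]) =1 rescale c.
  by move=> j; rewrite /rescale vE mevalM rmorphXn /= !mevalXU.
exists G.
  have [c' [c'0 gc']] := mpoly_nonvanishing_torus g0.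
  (* On the slice where the last parameter is 1, [rescale] just forgets it, so G is seen to be
     nonzero there. *)
  pose c (i : 'I_n.+2) := if unlift ord_max i is Some j then c' j else 1.
  have c1 : c ord_max = 1 by rewrite /c unlift_none.
  apply: contraNneq gc' => G0; have := GE c; rewrite G0 meval0 (meval_eq _ (uvE c)).
  have cc : rescale c =1 c' by move=> j; rewrite /rescale c1 !expr1n divr1 mulr1 /c liftK.
  rewrite (meval_eq _ cc) big1 => [|j _]; last by rewrite vE c1 expr1n.
  by rewrite expr1n mul1r => <- // j; rewrite vE c1 expr1n oner_neq0.
move=> c c0 Gc; apply/(PQ _ c0); apply: gQ; first exact: rescale_neq0.
have v0 j : (v j).@[c] != 0 by rewrite vE expf_neq0.
by apply: contraNneq Gc => g0'; have := GE c v0; rewrite (meval_eq _ (uvE c)) g0' mulr0 => ->.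
Qed.

End Rescale.

Lemma generic_ex n (P : ('I_n -> k) -> Prop) :
  generic P -> exists c, (forall j, c j != 0) /\ P c.
Proof.
case=> g g0 gP; have [c [c0 gc]] := mpoly_nonvanishing_torus g0.
by exists c; split=> //; apply: gP.
Qed.

End Generic.

(** The two predicates of N are equal, so [epsilon] agrees on them even when no N satisfies them. *)
Lemma eq_generic_value (k : fieldType) n1 n2 (P : ('I_n1 -> k) -> nat -> Prop)
    (Q : ('I_n2 -> k) -> nat -> Prop) :
  (forall N, generic (fun c => P c N) <-> generic (fun c => Q c N)) ->
  generic_value P = generic_value Q.
Proof.
move=> PQ; congr epsilon; apply: functional_extensionality => N.
exact: propositional_extensionality.
Qed.

(** * Counting points along an injection *)

Section Counting.
Variables (T T' : eqType) (phi : T -> T').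
Hypothesis phi_inj : injective phi.

Lemma seq_preimage (s : seq T') :
  (forall x, x \in s -> exists u, x = phi u) -> exists r, s = map phi r.
Proof.
elim: s => [|x s IH] sP; first by exists [::].
have [|r ->] := IH; first by move=> y ys; apply: sP; rewrite inE ys orbT.
by have [u ->] := sP x (mem_head _ _); exists (u :: r).
Qed.

Lemma has_card_bij (S : T -> Prop) (S' : T' -> Prop) N :
  (forall x, S' x <-> exists2 u, S u & x = phi u) -> has_card S' N <-> has_card S N.
Proof.
move=> SS'; split=> [[s [us sS <-]]|[s [us sS <-]]].
  have [|r sr] := @seq_preimage s.
    by move=> x /sS/SS'[u _ ->]; exists u.
  exists r; split; [by move: us; rewrite sr map_inj_uniq| |by rewrite sr size_map].
  move=> u; rewrite -(mem_map phi_inj) -sr -sS SS'; split=> [Su|[v Sv /phi_inj->]] //.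
  by exists u.
exists (map phi s); split; [by rewrite map_inj_uniq| |by rewrite size_map].
move=> x; rewrite SS'; split=> [[u /sS us' ->]|/mapP[u /sS Su ->]]; last by exists u.
exact: map_f.
Qed.

End Counting.

Lemma has_card_mult_bij (K : fieldType) n n' (J : {mpoly K[n]} -> Prop)
    (J' : {mpoly K[n']} -> Prop) (phi : {ffun 'I_n -> K} -> {ffun 'I_n' -> K})
    (S : {ffun 'I_n -> K} -> Prop) (S' : {ffun 'I_n' -> K} -> Prop) N :
  injective phi -> (forall x, S' x <-> exists2 u, S u & x = phi u) ->
  (forall u M, has_mult J' (phi u) M <-> has_mult J u M) ->
  has_card_mult J' S' N <-> has_card_mult J S N.
Proof.
move=> phi_inj SS' JJ'; split=> [[s [w [us sS sw ->]]]|[s [w [us sS sw ->]]]].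
  have [|r sr] := @seq_preimage _ _ phi s.
    by move=> x /sS/SS'[u _ ->]; exists u.
  exists r, (w \o phi); split; [by move: us; rewrite sr map_inj_uniq| | |].
  - move=> u; rewrite -(mem_map phi_inj) -sr -sS SS'; split=> [Su|[v Sv /phi_inj->]] //.
    by exists u.
  - by move=> u ur; apply/JJ'; apply: sw; rewrite sr map_f.
  - by rewrite sr big_map.
(* The weights are given on the source; an inverse of phi taken by choice moves them to the
   image. *)
pose inv (x : {ffun 'I_n' -> K}) := epsilon (inhabits [ffun=> 0]) (fun u => x = phi u).
have invK u : inv (phi u) = u.
  apply: phi_inj.
  rewrite -(epsilon_spec (inhabits [ffun=> 0]) (fun v => phi u = phi v)) //.
  by exists u.
exists (map phi s), (w \o inv); split.
- by rewrite map_inj_uniq.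
- move=> x; rewrite SS'; split=> [[u /sS us' ->]|/mapP[u /sS Su ->]]; last by exists u.
  exact: map_f.
- by move=> x /mapP[u us' ->]; rewrite /= invK; apply/JJ'; apply: sw.
- by rewrite big_map; apply: eq_bigr => u _; rewrite /= invK.
Qed.

(** * The reduction theorem *)

Section Reduction.
Variables (k : fieldType) (kb : closedFieldType) (iota : {rmorphism k -> kb}).
Hypothesis k_char0 : [pchar k] =i pred0.

Lemma zero_setP n (p : psystem k n) c x :
  zero_set iota p c x <-> forall j, (map_mpoly iota (p c j)).@[x] = 0.
Proof.
split=> [x0 j|x0 g [q ->]].
  apply: x0; exists (fun i => (i == j)%:R).
  rewrite (bigD1 j) //= eqxx mul1r big1 ?addr0 // => i /negbTE ->; exact: mul0r.
rewrite (rmorph_sum (map_mpoly iota)) (rmorph_sum (meval x)) big1 //= => j _.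
by rewrite rmorphM mevalM /= x0 mulr0.
Qed.

Lemma map_binomial_poly n (e e' : 'X_{1..n}) (c : k) :
  map_mpoly iota (binomial_poly e e' c) = binomial_poly e e' (iota c).
Proof. by rewrite /binomial_poly rmorphB /= map_mpolyZ !map_mpolyX. Qed.

Lemma map_reduction_subst n l m (g : {mpoly k[n.+2]}) :
  map_mpoly iota (g \mPo reduction_subst k n l m) =
  msubst (cusp_var kb l m) (map_mpoly iota g).
Proof.
move: g; apply: mpoly_ring_ind => [c|i|p q hp hq|p q hp hq].
- by rewrite comp_mpolyC !map_mpolyC msubstC.
- rewrite comp_mpolyXU -tnth_nth tnth_mktuple map_mpolyX msubstX /cusp_var.
  case: (unlift _ _) => [j|]; last by rewrite rmorphXn /= map_mpolyX.
  by case: eqP => _; rewrite ?rmorphXn /= map_mpolyX.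
- by rewrite !rmorphD /= hp hq.
- by rewrite !rmorphM /= hp hq.
Qed.

Variables (n : nat) (alpha beta : 'I_n.+2 -> 'X_{1..n.+2}) (l m a b : nat).
Hypothesis (l_gt0 : (0 < l)%N) (m_gt0 : (0 < m)%N).
Hypothesis alpha_last : alpha ord_max = (U_(ord_max) *+ l)%MM.
Hypothesis beta_last : beta ord_max = (U_(penult n) *+ m)%MM.
Hypothesis ab : (a * l = b * m + 1)%N.

Let p := binomial_system k alpha beta.
Let pt := reduced_system k l m alpha beta.

(** The exponent of c_n in the monomial t^e. *)
Let wt (e : 'X_{1..n.+2}) := (b * e (penult n) + a * e ord_max)%N.
Let resc (c : 'I_n.+2 -> k) : 'I_n.+1 -> k :=
  rescale (fun j => wt (beta (lift ord_max j))) (fun j => wt (alpha (lift ord_max j))) c.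

Let torus (c : 'I_n.+2 -> k) (i : 'I_n.+2) : kb :=
  if i == ord_max then iota (c ord_max) ^+ a
  else if i == penult n then iota (c ord_max) ^+ b else 1.

Let torus_mono c e : mmap1 (torus c) e = iota (c ord_max) ^+ wt e.
Proof.
have mp : penult n == ord_max = false by rewrite eq_sym; apply/negbTE/neq_lift.
rewrite /mmap1 (bigD1 ord_max) //= (bigD1 (penult n)) ?mp //= big1 ?mulr1.
  by rewrite /torus eqxx mp eqxx -!exprM -exprD /wt addnC.
by move=> i /andP[im ip]; rewrite /torus (negbTE im) (negbTE ip) expr1n.
Qed.

Section FixedParameter.
Variable c : 'I_n.+2 -> k.
Hypothesis c_neq0 : forall j, c j != 0.

Let ci i := iota (c i).
Let t := torus c.
Definition reduction_point : {ffun 'I_n.+1 -> kb} -> {ffun 'I_n.+2 -> kb} :=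
  torus_cusp_point l m t.

Let t_neq0 i : t i != 0.
Proof.
have c0 : iota (c ord_max) != 0 by rewrite fmorph_eq0.
by rewrite /t /torus; do 2?case: ifP => _; rewrite ?expf_neq0 ?oner_neq0.
Qed.

(** c_n t_(n-1)^m = c_n^(bm+1) = c_n^(al) = t_n^l; this equation dictates the exponents in
    [torus]. *)
Let ci_last : ci ord_max * mmap1 t (beta ord_max) = mmap1 t (alpha ord_max).
Proof.
have mp : penult n == ord_max = false by rewrite eq_sym; apply/negbTE/neq_lift.
rewrite !torus_mono /wt alpha_last beta_last !mulmnE !mnm1E eqxx mp eq_sym mp.
by rewrite !mul0n !muln0 !mul1n eqxx !mul1n addn0 add0n ab addn1 exprS.
Qed.

Let binomE j : map_mpoly iota (p c j) = binomial_poly (alpha j) (beta j) (ci j).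
Proof. exact: map_binomial_poly. Qed.

Let reducedE j : map_mpoly iota (pt (resc c) j) = reduced_binomial l m alpha beta ci t j.
Proof.
rewrite /pt /reduced_system map_reduction_subst map_binomial_poly /reduced_binomial.
congr (msubst _ (binomial_poly _ _ _)); rewrite !torus_mono /resc /rescale.
by rewrite !rmorphM fmorphV !rmorphXn.
Qed.

Let kb_char0 : [pchar kb] =i pred0.
Proof. by move=> q; rewrite (fmorph_pchar iota) k_char0. Qed.

Lemma reduction_point_inj : injective reduction_point.
Proof. exact (torus_cusp_point_inj l_gt0 ab t_neq0). Qed.

Lemma reduction_zeros x :
  zero_set iota p c x <-> exists2 u, zero_set iota pt (resc c) u & x = reduction_point u.
Proof.
have [to fro] := torus_cusp_zeros l_gt0 m_gt0 ab alpha_last beta_last t_neq0 ci_last x.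
rewrite zero_setP; split=> [x0|[u /zero_setP u0 xu] j].
  have [|u u0 ->] := to; first by move=> j; rewrite -binomE.
  by exists u => //; apply/zero_setP => j; rewrite reducedE.
by rewrite binomE; apply: fro; exists u => // i; rewrite -reducedE.
Qed.

Lemma reduction_mult u N :
  has_mult (ext_ideal iota p c) (reduction_point u) N <->
  has_mult (ext_ideal iota pt (resc c)) u N.
Proof.
have E1 : (fun j => map_mpoly iota (p c j)) = fun j => binomial_poly (alpha j) (beta j) (ci j).
  by apply: functional_extensionality => j; rewrite binomE.
have E2 : (fun j => map_mpoly iota (pt (resc c) j)) = reduced_binomial l m alpha beta ci t.
  by apply: functional_extensionality => j; rewrite reducedE.
rewrite /ext_ideal E1 E2.
exact: (torus_cusp_mult kb_char0 l_gt0 ab alpha_last beta_last t_neq0 ci_last).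
Qed.

Lemma reduction_stratum L u :
  stratum L (reduction_point u) <->
  (ord_max \in L) = (penult n \in L) /\ stratum (restrict_set L) u.
Proof. exact: torus_cusp_stratum. Qed.

End FixedParameter.

Lemma reduction_inv_D : inv_D iota p = inv_D iota pt.
Proof.
apply: eq_generic_value => N.
apply: (generic_rescale k_char0 (E := fun j => wt (beta (lift ord_max j)))
  (F := fun j => wt (alpha (lift ord_max j)))) => c c0.
by apply: (has_card_bij (reduction_point_inj c0)) => x; apply: reduction_zeros.
Qed.

Lemma reduction_inv_d : inv_d iota p = inv_d iota pt.
Proof.
apply: eq_generic_value => N.
apply: (generic_rescale k_char0 (E := fun j => wt (beta (lift ord_max j)))
  (F := fun j => wt (alpha (lift ord_max j)))) => c c0.
apply: (has_card_mult_bij N (reduction_point_inj c0)) => [x|u M].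
  exact: reduction_zeros.
exact: reduction_mult.
Qed.

(* When ord_max and penult n are not both in L or both outside it, the stratum
   contains no zero, so 0 is the only possible generic value. *)
Lemma reduction_inv_mu (L : {set 'I_n.+2}) :
  inv_mu iota p L =
    if (ord_max \in L) == (penult n \in L) then inv_mu iota pt (restrict_set L) else 0%N.
Proof.
case: eqP => [maxL|maxL].
  apply: eq_generic_value => N.
  apply: (generic_rescale k_char0 (E := fun j => wt (beta (lift ord_max j)))
    (F := fun j => wt (alpha (lift ord_max j)))) => c c0.
  apply: (has_card_mult_bij N (reduction_point_inj c0)) => [x|u M]; last exact: reduction_mult.
  rewrite reduction_zeros //; split=> [[[u u0 ->] /(reduction_stratum c0)[_ uL]]|[u [u0 uL] ->]].
    by exists u.
  by split; [exists u|apply/(reduction_stratum c0)].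
have empty c x : (forall j, c j != 0) -> ~ (zero_set iota p c x /\ stratum L x).
  by move=> c0; rewrite reduction_zeros // => -[[u _ ->] /(reduction_stratum c0)[]].
have gen0 : generic (fun c => has_card_mult (ext_ideal iota p c)
    (fun x => zero_set iota p c x /\ stratum L x) 0).
  exists 1 => [|c c0 _]; first exact: oner_neq0.
  exists [::], (fun=> 0%N); split=> // [x|]; last by rewrite big_nil.
  by split=> // /empty; case.
(* Since 0 is admissible, the value chosen by [epsilon] is admissible too. *)
have : generic (fun c => has_card_mult (ext_ideal iota p c)
    (fun x => zero_set iota p c x /\ stratum L x) (inv_mu iota p L)).
  by apply: (epsilon_spec (inhabits 0%N) (fun N => generic (fun c =>
    has_card_mult (ext_ideal iota p c) (fun x => zero_set iota p c x /\ stratum L x) N)));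
    exists 0%N.
case/(generic_ex k_char0) => c [c0 [[|x s] [w [_ sS _ ->]]]]; first by rewrite big_nil.
by case: (empty c x c0); apply/sS; rewrite mem_head.
Qed.

End Reduction.

Theorem theorem3p2 (k : fieldType) (kb : closedFieldType)
    (iota : {rmorphism k -> kb})
    (k_char0 : [pchar k] =i pred0)
    (kb_alg : forall z : kb, algebraicOver iota z)
    (n : nat) (alpha beta : 'I_n.+2 -> 'X_{1..n.+2}) (l m : nat)
    (alpha_neq_beta : forall j, alpha j != beta j)
    (alpha_neq0 : forall j, alpha j != 0%MM)
    (beta_neq0 : forall j, beta j != 0%MM)
    (l_gt0 : (0 < l)%N) (m_gt0 : (0 < m)%N) (lm_coprime : coprime l m)
    (alpha_last : alpha ord_max = (U_(ord_max) *+ l)%MM)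
    (beta_last : beta ord_max = (U_(penult n) *+ m)%MM)
    (p_gci : gci iota (binomial_system k alpha beta)) :
  let p := binomial_system k alpha beta in
  let pt := reduced_system k l m alpha beta in
  [/\ inv_D iota p = inv_D iota pt,
      forall L : {set 'I_n.+2},
        inv_mu iota p L =
          if (ord_max \in L) == (penult n \in L)
          then inv_mu iota pt (restrict_set L) else 0%N
    & inv_d iota p = inv_d iota pt].
Proof.
have [a b ab _] := egcdnP m l_gt0; rewrite (eqP lm_coprime) in ab.
split=> [|L|].
- exact: reduction_inv_D ab.
- exact: reduction_inv_mu ab L.
- exact: reduction_inv_d ab.
Qed.
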